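(* In the setting and under the standing assumptions (problem regularity, parameter, stochastic gradient and matrix assumptions) stated in the context, let $(x_\star,y_\star)$ be a stationary point of the problem with $x_\star\in\mathcal X$, and suppose there exist $\epsilon\in\mathbb R_{>0}$, $\mathcal H:\mathbb R^n\to\mathbb S^n$, $L_{\mathcal H}\in\mathbb R_{>0}$, $\mathcal M:\mathbb R^n\to\mathbb R^{m\times n}$ and $L_{\mathcal M}\in\mathbb R_{>0}$ such that, with $\mathcal X_{\epsilon,x_\star}:=\{x\in\mathbb R^n:\|x-x_\star\|_2\le\epsilon\}$: (i) $H_k=\mathcal H(X_k)$ whenever $X_k\in\mathcal X_{\epsilon,x_\star}$; (ii) $\|\mathcal H(x)-\mathcal H(\bar x)\|_2\le L_{\mathcal H}\|x-\bar x\|_2$ for all $x,\bar x\in\mathcal X_{\epsilon,x_\star}$; (iii) $M_k=\mathcal M(X_k)$ whenever $X_k\in\mathcal X_{\epsilon,x_\star}$; (iv) $\|\mathcal M(x)-\mathcal M(\bar x)\|_2\le L_{\mathcal M}\|x-\bar x\|_2$ for all $x,\bar x\in\mathcal X_{\epsilon,x_\star}$. Suppose that for some $\bar k\in\mathbb N$ one has almost surely that $\|X_k-x_\star\|_2\le\epsilon$ for all $k\in\mathbb N$ with $k\ge\bar k$. With $\Delta_k:=\nabla f(X_k)-G_k$ for all $k\in\mathbb N$, suppose further that (a) $\frac1k\mathbb E[\|M_i\Delta_i\|_2^2]<\infty$ for all $k\in\mathbb N$ and $i\in\{1,\dots,k\}$; (b) for all $\delta\in\mathbb R_{>0}$, $\frac1k\sum_{i=1}^k\mathbb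 E\big[\|M_i\Delta_i\|_2^2\,\mathbf 1_{\{\|M_i\Delta_i\|_2/\sqrt k>\delta\}}\,\big|\,\mathcal F_i\big]\to0$ in probability as $k\to\infty$; (c) $\frac1k\sum_{i=1}^k\mathbb E[M_i\Delta_i\Delta_i^TM_i^T|\mathcal F_i]\to\Sigma$ in probability as $k\to\infty$ for some $\Sigma\in\mathbb S^m$; (d) $\sup_{k\in\mathbb N}\mathbb E\big[\big\|\sum_{i=1}^k\frac1{\sqrt k}M_i\Delta_i\big\|_2^\Theta\big]<\infty$ for some $\Theta\in\mathbb R_{>1}$. Suppose finally that $X_k\to x_\star$ almost surely as $k\to\infty$. Then, with $Y_k^{\mathrm{avg}}:=\frac1{k-\bar k+1}\sum_{i=\bar k}^kY_i$ for all $k\ge\bar k$, almost surely as $k\to\infty$, $$Y_k^{\mathrm{true}}\to y_\star\quad\text{and}\quad Y_k^{\mathrm{avg}}\to y_\star.$$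
   Context: Notation. $\mathbb N$ is the set of positive integers; $\mathbb S^n$ is the set of symmetric real $n\times n$ matrices; $\|\cdot\|_2$ is the Euclidean norm of a vector and the spectral norm of a matrix; $A^\dagger=(A^TA)^{-1}A^T$ for $A$ of full column rank; $\mathbf 1_A$ is the indicator of the event $A$. $\nabla c(x)\in\mathbb R^{n\times m}$ denotes the transpose of the Jacobian of $c$ at $x$. Problem. $\min_{x\in\mathbb R^n} f(x)$ subject to $c(x)=0$, where $f(x)=\mathbb E_\iota[F(x,\iota)]$, $f:\mathbb R^n\to\mathbb R$ and $c:\mathbb R^n\to\mathbb R^m$ are continuously differentiable, and $\iota$ is a random variable with probability space $(\Omega_\iota,\mathcal F_\iota,\mathbb P_\iota)$. A stationary point is a pair $(x,y)\in\mathbb R^n\times\mathbb R^m$ with $\nabla f(x)+\nabla c(x)y=0$ and $c(x)=0$; then $x$ is called a primal stationary point. For $g\in\mathbb R^n$, $h\in\mathbb S^n$ and $d$ with $c(x)+\nabla c(x)^Td=0$, $\Delta q_\tau(x,g,h,d)=-\tau(g^Td+\tfrac12\max\{d^Thd,0\})+\|c(x)\|_1$. Algorithm (stochastic SQP). Inputs: $x_1\in\mathbb R^n$; constants $L_{\nabla f},\Gamma\in\mathbb R_{>0}$ that are Lipschitz constants over $\mathcal X$ (below), with respect to $\|\cdot\|_2$, of $\nabla f$ and $\nabla c$ respectively; $\tau,\xi\in\mathbb R_{>0}$; a sequence $\{\beta_k\}\subset(0,1]$ with $\sum_k\beta_k=\infty$ and $\sum_k\beta_k^2<\infty$. Set $X_1=x_1$.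 For each $k\in\mathbb N$: obtain a stochastic gradient estimator $G_k\in\mathbb R^n$ and a matrix $H_k\in\mathbb S^n$; compute $(D_k,Y_k)\in\mathbb R^n\times\mathbb R^m$ as the solution of $$\begin{bmatrix}H_k&\nabla c(X_k)\\ \nabla c(X_k)^T&0\end{bmatrix}\begin{bmatrix}D_k\\ Y_k\end{bmatrix}=-\begin{bmatrix}G_k\\ c(X_k)\end{bmatrix};$$ set $\alpha_k=\frac{\beta_k\tau\xi}{\tau L_{\nabla f}+\Gamma}\in(0,1]$ and $X_{k+1}=X_k+\alpha_kD_k$. Let $(D_k^{\mathrm{true}},Y_k^{\mathrm{true}})$ be the solution of the same system with $G_k$ replaced by $\nabla f(X_k)$. Define $M_k:=\nabla c(X_k)^\dagger(I-H_kZ_k(Z_k^TH_kZ_k)^{-1}Z_k^T)\in\mathbb R^{m\times n}$, where $Z_k\in\mathbb R^{n\times(n-m)}$ is a matrix whose columns form a basis for $\mathrm{Null}(\nabla c(X_k)^T)$. All random variables are defined on a probability space $(\Omega,\mathcal F,\mathbb P)$ with $\Omega=\prod_{k=1}^\infty\Omega_\iota$, where the $k$th component of $\omega\in\Omega$ determines the $k$th stochastic gradient estimate. $\mathcal F_1$ is the $\sigma$-algebra corresponding to the initial conditions and, for $k\ge2$, $\mathcal F_k$ is the $\sigma$-algebra defined by the initial conditions and $G_1,\dots,G_{k-1}$. Standing assumptions. (Problem regularity) There is an open convex set $\mathcal X\subseteq\mathbb R^n$ containing $\{X_k\}$ such that: $f$ is continuously differentiable and bounded below over $\mathcal X$; $\nabla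 f$ is bounded and Lipschitz continuous over $\mathcal X$; $c$ (with $m\le n$) is Lipschitz continuous, continuously differentiable and bounded over $\mathcal X$; $\nabla c^T$ is Lipschitz continuous over $\mathcal X$; and $\nabla c(x)^T$ has full row rank for all $x\in\mathcal X$ with singular values bounded below uniformly by a positive constant over $\mathcal X$. (Parameters) $\xi,\tau\in\mathbb R_{>0}$ are such that, for some $\nu\in(0,1)$ and for all $k\in\mathbb N$ in any run: (i) $\xi\le\frac{\Delta q_\tau(X_k,G_k,H_k,D_k)}{\tau\|D_k\|_2^2}$ whenever $D_k\ne0$; (ii) with $\rho_k:=\nabla f(X_k)^TD_k^{\mathrm{true}}+\max\{(D_k^{\mathrm{true}})^TH_kD_k^{\mathrm{true}},0\}$, $\tau\le\frac{(1-\nu)\|c(X_k)\|_1}{\rho_k}$ whenever $\rho_k>0$. (Stochastic gradients) For all $k$, $\mathbb E[G_k|\mathcal F_k]=\nabla f(X_k)$, and there is $\sigma\in\mathbb R_{>0}$ such that $\mathbb E[\|G_k-\nabla f(X_k)\|_2^2|\mathcal F_k]\le\sigma^2$ for all $k$. (Matrices) For all $k$, $H_k\in\mathbb S^n$ is $\mathcal F_k$-measurable with $\|H_k\|_2\le\kappa_H$ for some $\kappa_H\in\mathbb R_{>0}$, and there is $\zeta\in(0,\kappa_H]$ such that, for all $k$, $u^TH_ku\ge\zeta\|u\|_2^2$ for all $u\in\mathrm{Null}(\nabla c(X_k)^T)$. *)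

(* Defs.v *)
From HB Require Import structures.
From mathcomp Require Import all_boot all_order all_algebra.
From mathcomp Require Import all_classical all_reals all_analysis.

Set Implicit Arguments.
Unset Strict Implicit.
Unset Printing Implicit Defensive.

Import Order.TTheory GRing.Theory Num.Theory.
Import numFieldNormedType.Exports.

Local Open Scope classical_set_scope.
Local Open Scope ring_scope.

(* Vectors of R^n are column vectors. The norm that the library puts on
   matrices is the sup norm, so the Euclidean and spectral norms are defined
   here; the topology (convergence, openness, continuity) is the library's. *)

Definition dotv {R : realType} {n : nat} (u v : 'cV[R]_n) : R :=
  (u^T *m v) 0 0.

Definition norm2 {R : realType} {n : nat} (u : 'cV[R]_n) : R :=
  Num.sqrt (\sum_(i < n) u i 0 ^+ 2).

Definition norm1 {R : realType} {n : nat} (u : 'cV[R]_n) : R :=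
  \sum_(i < n) `|u i 0|.

Definition spectral_norm {R : realType} {p q : nat} (A : 'M[R]_(p, q)) : R :=
  sup [set norm2 (A *m u) | u in [set u : 'cV[R]_q | norm2 u <= 1]].

(* Used for p <= q, where the p singular values of A are the square roots of
   the eigenvalues of the p x p matrix A A^T. *)
Definition is_singular_value {R : realType} {p q : nat} (A : 'M[R]_(p, q))
    (s : R) : Prop :=
  0 <= s /\ eigenvalue (A *m A^T) (s ^+ 2).

Definition pinv {R : realType} {p q : nat} (A : 'M[R]_(p, q)) : 'M[R]_(q, p) :=
  invmx (A^T *m A) *m A^T.

Definition symmetric_mx {R : realType} {n : nat} (A : 'M[R]_n) : Prop :=
  A^T = A.

(* The columns of Z form a basis of Null(A^T); kermx A is the space of row
   vectors u with u *m A = 0. *)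
Definition null_basis {R : realType} {n m p : nat} (A : 'M[R]_(n, m))
    (Z : 'M[R]_(n, p)) : Prop :=
  (Z^T == kermx A)%MS /\ row_free Z^T.

Definition grad {R : realType} {n : nat} (f : 'cV[R]_n -> R) (x : 'cV[R]_n) :
    'cV[R]_n :=
  \col_(i < n) 'D_(delta_mx i 0) f x.

(* Transpose of the Jacobian: its j-th column is the gradient of c_j. *)
Definition gradc {R : realType} {n m : nat} (c : 'cV[R]_n -> 'cV[R]_m)
    (x : 'cV[R]_n) : 'M[R]_(n, m) :=
  \matrix_(i < n, j < m) 'D_(delta_mx i 0) (fun z => c z j 0) x.

(* N is the norm used on the codomain. *)
Definition lipschitz_with {R : realType} {n : nat} {V : zmodType} (N : V -> R)
    (A : set 'cV[R]_n) (g : 'cV[R]_n -> V) (L : R) : Prop :=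
  forall x y, A x -> A y -> N (g x - g y) <= L * norm2 (x - y).

Definition bounded_with {R : realType} {n : nat} {V : zmodType} (N : V -> R)
    (A : set 'cV[R]_n) (g : 'cV[R]_n -> V) : Prop :=
  exists B : R, forall x, A x -> N (g x) <= B.

Definition cball2 {R : realType} {n : nat} (x0 : 'cV[R]_n) (eps : R) :
    set 'cV[R]_n :=
  [set x | norm2 (x - x0) <= eps].

(* f and c are continuously differentiable on the whole space, hence over XX. *)
Record problem_regularity {R : realType} {n m : nat} (f : 'cV[R]_n -> R)
    (c : 'cV[R]_n -> 'cV[R]_m) (XX : set 'cV[R]_n) : Prop := {
  reg_le : (m <= n)%N ;
  reg_f_diff : forall x, differentiable f x ;
  reg_f_C1 : continuous (grad f) ;
  reg_c_diff : forall x, differentiable c x ;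
  reg_c_C1 : continuous (gradc c) ;
  reg_open : open XX ;
  reg_convex : convex_set XX ;
  reg_f_bounded_below : exists b : R, forall x, XX x -> b <= f x ;
  reg_gradf_bounded : bounded_with norm2 XX (grad f) ;
  reg_gradf_lipschitz :
    exists2 L : R, 0 < L & lipschitz_with norm2 XX (grad f) L ;
  reg_c_lipschitz : exists2 L : R, 0 < L & lipschitz_with norm2 XX c L ;
  reg_c_bounded : bounded_with norm2 XX c ;
  reg_gradc_lipschitz :
    exists2 L : R, 0 < L &
      lipschitz_with spectral_norm XX (fun x => (gradc c x)^T) L ;
  reg_full_rank : forall x, XX x -> row_free (gradc c x)^T ;
  reg_singular : exists2 s0 : R, 0 < s0 &
    forall x s, XX x -> is_singular_value (gradc c x)^T s -> s0 <= s
}.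

Definition stationary_point {R : realType} {n m : nat} (f : 'cV[R]_n -> R)
    (c : 'cV[R]_n -> 'cV[R]_m) (x : 'cV[R]_n) (y : 'cV[R]_m) : Prop :=
  grad f x + gradc c x *m y = 0 /\ c x = 0.

Definition delta_q {R : realType} {n m : nat} (c : 'cV[R]_n -> 'cV[R]_m)
    (tau : R) (x g : 'cV[R]_n) (h : 'M[R]_n) (d : 'cV[R]_n) : R :=
  - tau * (dotv g d + 2^-1 * Num.max (dotv d (h *m d)) 0) + norm1 (c x).

Definition newton_system {R : realType} {n m : nat}
    (c : 'cV[R]_n -> 'cV[R]_m) (x g : 'cV[R]_n) (h : 'M[R]_n)
    (d : 'cV[R]_n) (y : 'cV[R]_m) : Prop :=
  block_mx h (gradc c x) (gradc c x)^T 0 *m col_mx d y = - col_mx g (c x).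

Definition multiplier_mx {R : realType} {n m : nat} (A : 'M[R]_(n, m))
    (h : 'M[R]_n) (Z : 'M[R]_(n, n - m)) : 'M[R]_(m, n) :=
  pinv A *m (1%:M - h *m Z *m invmx (Z^T *m h *m Z) *m Z^T).

(* The countable product of copies of T with the product sigma-algebra. The
   factors are numbered from 1 in the mathematics and from 0 here. *)
Definition sample_paths {d : measure_display} (T : measurableType d) :=
  g_sigma_algebraType
    (\bigcup_(i in [set: nat])
       preimage_set_system setT (fun w : nat -> T => w i) measurable).

Definition sample_component {d : measure_display} {T : measurableType d}
    (k : nat) (w : sample_paths T) : T :=
  (w : nat -> T) k.-1.

Definition measurable_wrt {R : realType} {T : Type} {p q : nat}
    (F : set (set T)) (X : T -> 'M[R]_(p, q)) : Prop :=
  forall i j, preimage_set_system setT (fun w => X w i j) measurable `<=` F.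

(* F_k: generated by the initial conditions F1 and G_1, ..., G_(k-1). *)
Definition history {R : realType} {T : Type} {n : nat} (F1 : set (set T))
    (G : nat -> T -> 'cV[R]_n) (k : nat) : set (set T) :=
  <<s F1 `|` \bigcup_(i in [set i | (0 < i < k)%N]) \bigcup_(j in [set: 'I_n])
         preimage_set_system setT (fun w => G i w j 0) measurable >>.

(* V is a version of the conditional expectation E[X | F], for integrable X
   and a sub-sigma-algebra F. *)
Definition is_cond_exp {R : realType} {d : measure_display}
    {T : measurableType d} (P : probability T R) (F : set (set T))
    (X V : T -> R) : Prop :=
  [/\ P.-integrable setT (EFin \o X),
      P.-integrable setT (EFin \o V),
      preimage_set_system setT V measurable `<=` F &
      forall A, F A ->
        (\int[P]_(w in A) (V w)%:E = \int[P]_(w in A) (X w)%:E)%E].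

Definition is_cond_exp_mx {R : realType} {d : measure_display}
    {T : measurableType d} {p q : nat} (P : probability T R)
    (F : set (set T)) (X V : T -> 'M[R]_(p, q)) : Prop :=
  forall i j, is_cond_exp P F (fun w => X w i j) (fun w => V w i j).

Definition cvg_in_prob {R : realType} {d : measure_display}
    {T : measurableType d} (P : probability T R) (X : nat -> T -> R) (l : R) :
    Prop :=
  forall e : R, 0 < e ->
    (fun k => P [set w | e < `|X k w - l|]) @ \oo --> 0%E.

(* Main.v *)
Require Import Defs.
From HB Require Import structures.
From mathcomp Require Import all_boot all_order all_algebra.
From mathcomp Require Import all_classical all_reals all_analysis.
From mathcomp Require Import finmap measurable_realfun.
From mathcomp Require Import ring lra zify.

Set Implicit Arguments.
Unset Strict Implicit.
Unset Printing Implicit Defensive.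

Import Order.TTheory GRing.Theory Num.Theory.
Import numFieldNormedType.Exports.

Local Open Scope classical_set_scope.
Local Open Scope ring_scope.

(** Both limits are consequences of one fact about the saddle-point matrices
    [K_k = [H_k, A_k; A_k^T, 0]], where [A_k] is the gradient of [c] at [X_k]:
    they are invertible, and the multiplier part of the solution of
    [K_k (d, y) = (g, h)] satisfies [|y| <= B (|g| + |h|)] with a constant [B]
    that depends only on the uniform bounds on the singular values of [A_k],
    on [|H_k|] and on the curvature of [H_k] on the null space of [A_k^T]
    ([saddle_stability], fed by [singular_value_lower_bound]).

    True multipliers: [(Dtrue_k, Ytrue_k - ystar)] solves the saddle-point system
    whose right-hand side is the defect of [(xstar, ystar)] at [X_k]. By Lipschitz
    continuity that defect is [O(|X_k - xstar|)], hence so is [Ytrue_k - ystar]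
    ([multiplier_error_bound]), and it vanishes in the limit.

    Averaged multipliers: subtracting the two systems that define [Y_k] and
    [Ytrue_k] gives [Y_k - Ytrue_k = N_k Delta_k], where [N_k] is the lower left
    block of the inverse of [K_k] ([multiplier_noiseE]). This block is the
    matrix [M_k] of the algorithm, but in this form it visibly depends on
    [X_k] and [H_k] only, so it is measurable with respect to the history
    [F_k], and it is bounded by [B]. As [Delta_k] has conditional mean zero and
    bounded second moment, the differences [Y_k - Ytrue_k] have bounded second
    moments and are pairwise uncorrelated.

    A strong law of large numbers holds for such sequences
    ([orthogonal_slln]): the averages over the first [k^2] terms have variance
    [O(1/k^2)], which is summable, so they converge almost surely along the
    squares; and the blocks between consecutive squares are short enough that
    Cauchy-Schwarz, without any cancellation, bounds their contributions by a
    summable sequence. The averages of [Y_k] therefore have the same limit as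
    those of [Ytrue_k], which is [ystar] by the lemma of Cesaro. *)

(** * Euclidean and spectral norms *)

Section euclidean.
Context {R : realType}.
Implicit Types n p q : nat.

Lemma dotvE n (u v : 'cV[R]_n) : dotv u v = \sum_(i < n) u i 0 * v i 0.
Proof. by rewrite /dotv mxE; apply: eq_bigr => i _; rewrite mxE. Qed.

Lemma dotvC n (u v : 'cV[R]_n) : dotv u v = dotv v u.
Proof. by rewrite !dotvE; apply: eq_bigr => i _; rewrite mulrC. Qed.

Lemma dotvDr n (u v w : 'cV[R]_n) : dotv u (v + w) = dotv u v + dotv u w.
Proof. by rewrite /dotv mulmxDr mxE. Qed.

Lemma dotvDl n (u v w : 'cV[R]_n) : dotv (v + w) u = dotv v u + dotv w u.
Proof. by rewrite dotvC dotvDr !(dotvC u). Qed.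

Lemma dotvZr n a (u v : 'cV[R]_n) : dotv u (a *: v) = a * dotv u v.
Proof. by rewrite /dotv -scalemxAr mxE. Qed.

Lemma dotvZl n a (u v : 'cV[R]_n) : dotv (a *: u) v = a * dotv u v.
Proof. by rewrite dotvC dotvZr dotvC. Qed.

Lemma dotvNr n (u v : 'cV[R]_n) : dotv u (- v) = - dotv u v.
Proof. by rewrite -scaleN1r dotvZr mulN1r. Qed.

Lemma dotv_trmx p q (A : 'M[R]_(p, q)) u v :
  dotv u (A *m v) = dotv (A^T *m u) v.
Proof. by rewrite /dotv trmx_mul trmxK mulmxA. Qed.

Lemma norm2_ge0 n (u : 'cV[R]_n) : 0 <= norm2 u.
Proof. exact: sqrtr_ge0. Qed.

Lemma norm2_sqr n (u : 'cV[R]_n) : norm2 u ^+ 2 = dotv u u.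
Proof.
rewrite sqr_sqrtr ?dotvE; last by apply: sumr_ge0 => i _; exact: sqr_ge0.
by apply: eq_bigr => i _; rewrite expr2.
Qed.

Lemma dotv_ge0 n (u : 'cV[R]_n) : 0 <= dotv u u.
Proof. by rewrite -norm2_sqr sqr_ge0. Qed.

(** A quadratic polynomial in [t] that is nonnegative everywhere, here the form
    at [t u + v], has a nonpositive discriminant. Stated for an arbitrary
    semidefinite form because the bound on singular values needs it for a shift
    of the Gram matrix. *)
Lemma psd_cauchy_schwarz n (B : 'M[R]_n) (u v : 'cV[R]_n) :
  B^T = B -> (forall w : 'cV[R]_n, 0 <= dotv w (B *m w)) ->
  dotv u (B *m v) ^+ 2 <= dotv u (B *m u) * dotv v (B *m v).
Proof.
move=> Bsym Bge0.
set a := dotv u (B *m u); set b := dotv u (B *m v); set c := dotv v (B *m v).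
have bC : dotv v (B *m u) = b by rewrite dotv_trmx Bsym dotvC.
have quad t : 0 <= a * t ^+ 2 + 2 * b * t + c.
  have := Bge0 (t *: u + v).
  rewrite mulmxDr -scalemxAr dotvDr !dotvDl !dotvZr !dotvZl -/a -/b -/c bC.
  by congr (0 <= _); ring.
have a0 : 0 <= a by exact: Bge0.
have c0 : 0 <= c by exact: Bge0.
have [aeq0|an0] := eqVneq a 0.
  (* The polynomial is affine; if it had a slope, it would be -1 at this t. *)
  have [->|bn0] := eqVneq b 0; first by rewrite expr0n mulr_ge0.
  have := quad (- (c + 1) / (2 * b)).
  rewrite aeq0 mul0r add0r mulrCA divff ?mulr1; last by rewrite mulf_neq0.
  lra.
have agt0 : 0 < a by rewrite lt_def an0.
have := mulr_ge0 a0 (quad (- b / a)).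
have -> : a * (a * (- b / a) ^+ 2 + 2 * b * (- b / a) + c) = a * c - b ^+ 2.
  by field.
by rewrite subr_ge0.
Qed.

Lemma cauchy_schwarz n (u v : 'cV[R]_n) : `|dotv u v| <= norm2 u * norm2 v.
Proof.
rewrite -(@ler_pXn2r _ 2) ?nnegrE ?normr_ge0 ?mulr_ge0 ?norm2_ge0//.
rewrite real_normK ?num_real// exprMn !norm2_sqr.
have := @psd_cauchy_schwarz n 1%:M u v (trmx1 _ _).
by rewrite !mul1mx; apply=> w; rewrite mul1mx dotv_ge0.
Qed.

Lemma norm2D n (u v : 'cV[R]_n) : norm2 (u + v) <= norm2 u + norm2 v.
Proof.
rewrite -(@ler_pXn2r _ 2) ?nnegrE ?addr_ge0 ?norm2_ge0//.
rewrite sqrrD !norm2_sqr dotvDr !dotvDl (dotvC v u).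
have := le_trans (ler_norm _) (cauchy_schwarz u v); lra.
Qed.

Lemma norm2Z n a (u : 'cV[R]_n) : norm2 (a *: u) = `|a| * norm2 u.
Proof.
apply/eqP; rewrite -(@eqrXn2 _ 2) ?mulr_ge0 ?norm2_ge0 ?normr_ge0//.
by rewrite exprMn !norm2_sqr dotvZl dotvZr real_normK ?num_real// expr2 mulrA.
Qed.

Lemma norm2N n (u : 'cV[R]_n) : norm2 (- u) = norm2 u.
Proof. by rewrite -scaleN1r norm2Z normrN normr1 mul1r. Qed.

Lemma norm20 n : norm2 (0 : 'cV[R]_n) = 0.
Proof. by rewrite -(scale0r 0) norm2Z normr0 mul0r. Qed.

Lemma norm2_eq0 n (u : 'cV[R]_n) : norm2 u = 0 -> u = 0.
Proof.
move=> u0; have := norm2_sqr u.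
rewrite u0 expr0n dotvE /= => /esym/eqP.
rewrite psumr_eq0 => [/allP h|i _]; last by rewrite -expr2 sqr_ge0.
apply/matrixP => i j; rewrite ord1 mxE; apply/eqP.
by have := h i (mem_index_enum _); rewrite mulf_eq0 orbb.
Qed.

Lemma norm2B_le n (u v : 'cV[R]_n) : norm2 (u - v) <= norm2 u + norm2 v.
Proof. by rewrite -(norm2N v) norm2D. Qed.

Lemma normr_le_norm2 n (u : 'cV[R]_n) i : `|u i 0| <= norm2 u.
Proof.
rewrite -(@ler_pXn2r _ 2) ?nnegrE ?normr_ge0 ?norm2_ge0//.
rewrite real_normK ?num_real// norm2_sqr dotvE (bigD1 i)//= -expr2 lerDl.
by apply: sumr_ge0 => j _; rewrite -expr2 sqr_ge0.
Qed.

Lemma norm2_le_sum n (u : 'cV[R]_n) : norm2 u <= \sum_i `|u i 0|.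
Proof.
rewrite -(@ler_pXn2r _ 2) ?nnegrE ?sumr_ge0 ?norm2_ge0//.
rewrite norm2_sqr dotvE expr2 mulr_suml; apply: ler_sum => i _.
rewrite -expr2 -real_normK ?num_real// expr2 ler_wpM2l ?normr_ge0//.
by rewrite (bigD1 i)//= lerDl sumr_ge0.
Qed.

Lemma mulmx_norm2_bounded p q (A : 'M[R]_(p, q)) :
  exists2 C, 0 < C & forall u, norm2 (A *m u) <= C * norm2 u.
Proof.
exists (1 + \sum_i \sum_j `|A i j|).
  by rewrite ltr_pwDl// sumr_ge0// => i _; exact: sumr_ge0.
move=> u; rewrite mulrDl mul1r (le_trans (norm2_le_sum _))//.
rewrite (@le_trans _ _ ((\sum_i \sum_j `|A i j|) * norm2 u))//; last first.
  by rewrite lerDr norm2_ge0.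
rewrite mulr_suml; apply: ler_sum => i _.
rewrite mxE mulr_suml (le_trans (ler_norm_sum _ _ _))//.
apply: ler_sum => j _; rewrite normrM ler_wpM2l//.
exact: normr_le_norm2.
Qed.

(** The spectral norm is a supremum of reals, which is an upper bound only
    because matrices are bounded operators. *)
Lemma norm2_mulmx_spectral p q (A : 'M[R]_(p, q)) u :
  norm2 (A *m u) <= spectral_norm A * norm2 u.
Proof.
have [u0|un0] := eqVneq (norm2 u) 0.
  by rewrite (norm2_eq0 u0) mulmx0 !norm20 mulr0.
have ugt0 : 0 < norm2 u by rewrite lt_def un0 norm2_ge0.
have [C C0 HC] := mulmx_norm2_bounded A.
rewrite -ler_pdivrMr//.
have -> : norm2 (A *m u) / norm2 u = norm2 (A *m ((norm2 u)^-1 *: u)).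
  by rewrite -scalemxAr norm2Z ger0_norm ?invr_ge0 ?norm2_ge0// mulrC.
apply: ub_le_sup.
  exists C => _ [v /= v1 <-]; apply: le_trans (HC v) _.
  by rewrite -[leRHS]mulr1 ler_wpM2l// ltW.
exists ((norm2 u)^-1 *: u) => //=.
by rewrite norm2Z ger0_norm ?invr_ge0 ?norm2_ge0// mulVf.
Qed.

End euclidean.

(** * Stability of saddle-point systems *)

Section saddle.
Context {R : realType}.
(** The infimum [lam] of [|A z|^2] over the unit sphere is an eigenvalue of
    [A^T A], so its square root is a singular value. Otherwise [A^T A - lam],
    which is semidefinite, would be invertible, and an invertible semidefinite
    form is bounded away from zero on the unit sphere. *)
Lemma singular_value_lower_bound n m (A : 'M[R]_(n, m)) (s0 : R) :
  0 < s0 -> (forall s, is_singular_value A^T s -> s0 <= s) ->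
  forall y : 'cV[R]_m, s0 * norm2 y <= norm2 (A *m y).
Proof.
move=> s0gt0 sing y.
have [y0|yn0] := eqVneq (norm2 y) 0; first by rewrite y0 mulr0 norm2_ge0.
have ygt0 : 0 < norm2 y by rewrite lt_def yn0 norm2_ge0.
pose q (z : 'cV[R]_m) := norm2 (A *m z) ^+ 2.
have qE z : q z = dotv z (A^T *m A *m z).
  by rewrite /q norm2_sqr dotv_trmx dotvC mulmxA.
have qZ a z : q (a *: z) = a ^+ 2 * q z.
  by rewrite /q -scalemxAr norm2Z exprMn real_normK ?num_real.
pose S := [set q z | z in [set z | norm2 z = 1]].
have normalize z : norm2 z != 0 -> S ((norm2 z) ^- 2 * q z).
  move=> zn0; exists ((norm2 z)^-1 *: z); last by rewrite qZ exprVn.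
  by rewrite /= norm2Z ger0_norm ?invr_ge0 ?norm2_ge0// mulVf.
have S0 : S !=set0 by eexists; exact: normalize yn0.
have Slb : lbound S 0 by move=> _ [z _ <-]; exact: sqr_ge0.
pose lam := inf S.
have lam0 : 0 <= lam by exact: lb_le_inf.
have lamq z : lam * norm2 z ^+ 2 <= q z.
  have [z0|zn0] := eqVneq (norm2 z) 0.
    by rewrite z0 expr0n mulr0 sqr_ge0.
  rewrite -ler_pdivlMr ?exprn_gt0 ?lt_def ?zn0 ?norm2_ge0// mulrC.
  by apply: ge_inf; [exists 0|exact: normalize].
suff s0lam : s0 ^+ 2 <= lam.
  rewrite -(@ler_pXn2r _ 2) ?nnegrE ?mulr_ge0 ?norm2_ge0// ?(ltW s0gt0)//.
  by rewrite exprMn (le_trans _ (lamq y))// ler_wpM2r// sqr_ge0.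
suff eig : eigenvalue (A^T *m A) lam.
  have : s0 <= Num.sqrt lam.
    by apply: sing; split; [exact: sqrtr_ge0|rewrite trmxK sqr_sqrtr].
  by move=> h; rewrite -(sqr_sqrtr lam0) ler_pXn2r ?nnegrE ?sqrtr_ge0 ?(ltW s0gt0).
apply: contraT; rewrite /eigenvalue negbK /eigenspace kermx_eq0 row_free_unit.
set B := _ - _ => Bunit.
have Bsym : B^T = B by rewrite /B !linearB/= trmx_mul trmxK tr_scalar_mx.
have BqE z : dotv z (B *m z) = q z - lam * norm2 z ^+ 2.
  by rewrite /B mulmxBl dotvDr dotvNr -qE mul_scalar_mx dotvZr norm2_sqr.
have Bpsd z : 0 <= dotv z (B *m z) by rewrite BqE subr_ge0.
have [C C0 HC] := mulmx_norm2_bounded (invmx B).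
(* Cauchy-Schwarz for the form B, applied to z and B^-1 z, gives
   |z|^4 <= <z, B z> <B^-1 z, z>, and the last factor is at most C |z|^2. *)
have : lam + C^-1 <= lam.
  apply: lb_le_inf => // _ [z z1 <-].
  have := psd_cauchy_schwarz z (invmx B *m z) Bsym Bpsd.
  rewrite mulKVmx// -norm2_sqr z1 expr1n expr1n BqE z1 expr1n mulr1.
  have : dotv (invmx B *m z) z <= C.
    have := le_trans (ler_norm _) (cauchy_schwarz (invmx B *m z) z).
    rewrite z1 mulr1 => /le_trans; apply.
    by have := HC z; rewrite z1 mulr1.
  move=> dC h1; rewrite -lerBrDl -[C^-1]mul1r ler_pdivrMr//.
  apply: le_trans h1 _; apply: ler_wpM2l => //.
  by have := lamq z; rewrite z1 expr1n mulr1 subr_ge0.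
by rewrite gerDl leNgt invr_gt0 C0.
Qed.

Definition saddle_mx n m (H : 'M[R]_n) (A : 'M[R]_(n, m)) : 'M[R]_(n + m) :=
  block_mx H A A^T 0.

Lemma saddle_mxE n m (H : 'M[R]_n) (A : 'M[R]_(n, m))
    (d : 'cV[R]_n) (y : 'cV[R]_m) :
  saddle_mx H A *m col_mx d y = col_mx (H *m d + A *m y) (A^T *m d).
Proof. by rewrite /saddle_mx mul_block_col mul0mx addr0. Qed.

Section stability.
Variables (n m : nat) (H : 'M[R]_n) (A : 'M[R]_(n, m)) (s0 kappa zeta : R).
Hypotheses (s0_gt0 : 0 < s0) (kappa_gt0 : 0 < kappa) (zeta_gt0 : 0 < zeta).
Hypothesis A_low : forall y : 'cV[R]_m, s0 * norm2 y <= norm2 (A *m y).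
Hypothesis H_up : forall u : 'cV[R]_n, norm2 (H *m u) <= kappa * norm2 u.
Hypothesis H_coer : forall u : 'cV[R]_n, A^T *m u = 0 ->
  zeta * norm2 u ^+ 2 <= dotv u (H *m u).

Lemma gram_unit : A^T *m A \in unitmx.
Proof.
rewrite -row_free_unit -kermx_eq0; apply/eqP/row_matrixP => i; rewrite row0.
set r := row i _.
have r0 : r *m (A^T *m A) = 0 by rewrite /r -row_mul mulmx_ker row0.
have Ar0 : norm2 (A *m r^T) ^+ 2 = 0.
  rewrite norm2_sqr /dotv -[A *m r^T]trmxK trmx_mul trmxK.
  by rewrite trmxK trmx_mul trmxK mulmxA -[r *m A^T *m A]mulmxA r0 mul0mx mxE.
have : s0 * norm2 r^T <= 0.
  by have := A_low r^T; move/eqP: Ar0; rewrite sqrf_eq0 => /eqP ->.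
rewrite pmulr_rle0// => r0'; have /eqP : norm2 r^T == 0.
  by rewrite eq_le r0' norm2_ge0.
by move/norm2_eq0 => /(congr1 trmx); rewrite trmxK trmx0.
Qed.

(** The minimum-norm solution [A (A^T A)^-1 h] of the constraint. *)
Lemma saddle_min_norm (h : 'cV[R]_m) :
  exists2 v : 'cV[R]_n, A^T *m v = h & norm2 v <= s0^-1 * norm2 h.
Proof.
pose w := invmx (A^T *m A) *m h; exists (A *m w).
  by rewrite /w !mulmxA mulmxV ?gram_unit// mul1mx.
have [->|Aw0] := eqVneq (norm2 (A *m w)) 0.
  by rewrite mulr_ge0 ?invr_ge0 ?norm2_ge0// ltW.
have Aw_gt0 : 0 < norm2 (A *m w) by rewrite lt_def Aw0 norm2_ge0.
have : norm2 (A *m w) ^+ 2 = dotv w h.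
  rewrite norm2_sqr dotv_trmx dotvC; congr dotv.
  by rewrite /w !mulmxA mulmxV ?gram_unit// mul1mx.
move=> E; rewrite -(ler_pM2l Aw_gt0) -expr2 E.
rewrite (le_trans (ler_norm _))// (le_trans (cauchy_schwarz _ _))//.
rewrite mulrA ler_wpM2r ?norm2_ge0// mulrC -ler_pdivrMl ?invr_gt0// invrK.
exact: A_low.
Qed.

Definition primal_bound : R := zeta^-1 * (1 + kappa * s0^-1) + s0^-1.

Definition dual_bound : R := s0^-1 * (1 + kappa * primal_bound).

Lemma dual_bound_ge0 : 0 <= dual_bound.
Proof.
have p : 0 <= s0^-1 by rewrite invr_ge0 ltW.
have q : 0 <= zeta^-1 by rewrite invr_ge0 ltW.
have r := ltW kappa_gt0.
rewrite /dual_bound /primal_bound.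
by do 3 rewrite mulr_ge0// addr_ge0//; rewrite mulr_ge0.
Qed.

(** The part [v] of [d] that accounts for the constraint is bounded because [A^T]
    has a bounded right inverse. The rest, [u = d - v], lies in the null space
    of [A^T]; testing the first equation with [u] removes [y], and coercivity
    of [H] there bounds [u]. Finally [A y = g - H d] bounds [y]. *)
Lemma saddle_stability (g : 'cV[R]_n) (h : 'cV[R]_m)
    (d : 'cV[R]_n) (y : 'cV[R]_m) :
  H *m d + A *m y = g -> A^T *m d = h ->
  norm2 d <= primal_bound * (norm2 g + norm2 h) /\
  norm2 y <= dual_bound * (norm2 g + norm2 h).
Proof.
move=> eg eh.
have s0i : 0 < s0^-1 by rewrite invr_gt0.
have zi : 0 < zeta^-1 by rewrite invr_gt0.
have [v Av vle] := saddle_min_norm h.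
pose u := d - v.
have Au : A^T *m u = 0 by rewrite /u mulmxBr Av eh subrr.
have Huu : dotv u (H *m u) = dotv u g - dotv u (H *m v).
  have uAy : dotv u (A *m y) = 0.
    by rewrite dotv_trmx Au dotvE big1// => i _; rewrite mxE mul0r.
  by rewrite -eg dotvDr uAy addr0 -dotvNr -dotvDr -mulmxBr.
have N0 k (z : 'cV[R]_k) : 0 <= norm2 z := norm2_ge0 z.
have gh : 0 <= norm2 g + norm2 h by rewrite addr_ge0.
have vle' : norm2 v <= s0^-1 * (norm2 g + norm2 h).
  by rewrite (le_trans vle)// ler_wpM2l ?(ltW s0i)// lerDr.
have ule : norm2 u <= zeta^-1 * (1 + kappa * s0^-1) * (norm2 g + norm2 h).
  have [->|un0] := eqVneq (norm2 u) 0.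
    by rewrite !mulr_ge0// ?(ltW zi)// addr_ge0// mulr_ge0 ?ltW.
  have ugt0 : 0 < norm2 u by rewrite lt_def un0 N0.
  have c1 := le_trans (ler_norm _) (cauchy_schwarz u g).
  have c2 := le_trans (ler_norm _) (cauchy_schwarz u (- (H *m v))).
  have hv := H_up v.
  rewrite -mulrA -ler_pdivrMl ?invr_gt0// invrK -(ler_pM2l ugt0).
  have -> : norm2 u * (zeta * norm2 u) = zeta * norm2 u ^+ 2 by ring.
  apply: le_trans (H_coer Au) _; rewrite Huu.
  rewrite -dotvNr (le_trans (lerD c1 c2))// -mulrDr ler_wpM2l// norm2N.
  rewrite mulrDl mul1r lerD ?lerDl// -mulrA (le_trans hv)//.
  by rewrite ler_wpM2l// ltW.
have dle : norm2 d <= primal_bound * (norm2 g + norm2 h).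
  by rewrite -[d](subrK v) (le_trans (norm2D _ _))// mulrDl lerD.
split=> //.
have : norm2 (A *m y) <= norm2 g + kappa * norm2 d.
  have -> : A *m y = g - H *m d by rewrite -eg addrC addKr.
  by rewrite (le_trans (norm2B_le _ _))// lerD2l.
move/(le_trans (A_low y)) => yle.
rewrite -mulrA -ler_pdivrMl ?invr_gt0// invrK (le_trans yle)//.
rewrite mulrDl mul1r lerD ?lerDl// -mulrA ler_wpM2l//.
exact: ltW.
Qed.

(** A vector in the kernel solves the system with zero right-hand side, so it
    vanishes by stability. *)
Lemma saddle_unit : saddle_mx H A \in unitmx.
Proof.
have symE : (saddle_mx H A)^T = saddle_mx H^T A.
  by rewrite /saddle_mx tr_block_mx trmxK trmx0.
rewrite -unitmx_tr -row_free_unit -kermx_eq0.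
apply/eqP/row_matrixP => i; rewrite row0; set r := row i _.
have r0 : r *m (saddle_mx H A)^T = 0 by rewrite /r -row_mul mulmx_ker row0.
have : saddle_mx H A *m r^T = 0.
  by apply: trmx_inj; rewrite trmx_mul trmxK r0 trmx0.
rewrite -[r^T]vsubmxK saddle_mxE -col_mx0 => /eq_col_mx[e1 e2].
have [] := saddle_stability e1 e2; rewrite !norm20 addr0 !mulr0 => d0 y0.
have z k (z : 'cV[R]_k) : norm2 z <= 0 -> z = 0.
  by move=> zz; apply: norm2_eq0; apply/eqP; rewrite eq_le zz norm2_ge0.
apply: trmx_inj; rewrite -[r^T]vsubmxK (z _ _ d0) (z _ _ y0) col_mx0.
by rewrite trmx0.
Qed.

End stability.
End saddle.

(** * A strong law of large numbers for uncorrelated variables *)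

Section slln.
Context d (T : measurableType d) (R : realType) (P : probability T R).
Implicit Types f g : T -> R.

Lemma integrable_mul_sqr f g :
  measurable_fun setT f -> measurable_fun setT g ->
  P.-integrable setT (EFin \o (fun w => f w ^+ 2)) ->
  P.-integrable setT (EFin \o (fun w => g w ^+ 2)) ->
  P.-integrable setT (EFin \o (fun w => f w * g w)).
Proof.
move=> mf mg f2 g2.
apply: (le_integrable measurableT _ _ (integrableD measurableT f2 g2)).
  by apply/measurable_EFinP; exact: measurable_funM.
move=> w _ /=; rewrite lee_fin normrM [leRHS]ger0_norm ?addr_ge0 ?sqr_ge0//.
rewrite -(@real_normK _ (f w)) ?num_real// -(@real_normK _ (g w)) ?num_real//.
have := mulr_ge0 (normr_ge0 (f w)) (normr_ge0 (g w)).
have := sqr_ge0 (`|f w| - `|g w|); rewrite sqrrB; lra.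
Qed.

Section orthogonal.
Variables (x : nat -> T -> R) (C : R).
Hypothesis mx : forall i, measurable_fun setT (x i).
Hypothesis ix : forall i, P.-integrable setT (EFin \o (fun w => x i w ^+ 2)).
Hypothesis bx : forall i, (\int[P]_w (x i w ^+ 2)%:E <= C%:E)%E.
Hypothesis ox : forall i j, (i < j)%N -> (\int[P]_w (x i w * x j w)%:E = 0)%E.

Let S n w := \sum_(i < n) x i w.

Let mS n : measurable_fun setT (S n).
Proof. by apply: measurable_sum => i. Qed.

(** The cross terms vanish, so variances add up. *)
Lemma orthogonal_sum_sqr n :
  P.-integrable setT (EFin \o (fun w => S n w ^+ 2)) /\
  (\int[P]_w (S n w ^+ 2)%:E <= (n%:R * C)%:E)%E.
Proof.
elim: n => [|n [IH1 IH2]].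
  have -> : (fun w => S 0 w ^+ 2) = cst 0.
    by apply/funext => w; rewrite /S big_ord0 expr0n.
  split; first exact: integrable0.
  rewrite (_ : (fun w => _) = cst 0%E) ?integral0 ?mul0r//.
  by apply/funext => w; rewrite /S big_ord0 expr0n.
have i2 := ix n.
have crossE w : S n w * x n w = \sum_(i < n) x i w * x n w by rewrite mulr_suml.
have cI := integrable_mul_sqr (mS n) (mx n) IH1 i2.
have cZ : (\int[P]_w (S n w * x n w)%:E = 0)%E.
  under eq_integral do rewrite crossE -sumEFin.
  rewrite integral_sum//; last by move=> i; exact: integrable_mul_sqr.
  by rewrite big1// => i _; exact: ox.
have i3 : P.-integrable setT (EFin \o (fun w => 2 * (S n w * x n w))).
  have -> : EFin \o (fun w => 2 * (S n w * x n w)) =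
            (fun w => 2%:E * (EFin \o (fun w => S n w * x n w)%R) w)%E by [].
  exact: integrableZl.
have i12 : P.-integrable setT
    (EFin \o ((fun w => S n w ^+ 2) \+ (fun w => x n w ^+ 2))).
  exact: (integrableD measurableT IH1 i2).
have SE : (fun w => S n.+1 w ^+ 2) =
    ((fun w => S n w ^+ 2) \+ (fun w => x n w ^+ 2)) \+
    (fun w => 2 * (S n w * x n w)).
  by apply/funext => w /=; rewrite /S big_ord_recr/= -/(S n w); ring.
split.
  by rewrite SE; exact: (integrableD measurableT i12 i3).
have -> : (\int[P]_w (S n.+1 w ^+ 2)%:E = \int[P]_w (S n w ^+ 2)%:E +
   \int[P]_w (x n w ^+ 2)%:E)%E.
  transitivity (\int[P]_w (EFin \o (fun w => S n.+1 w ^+ 2)%R) w)%E => //.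
  rewrite SE integralD_EFin// integralD_EFin//.
  under [X in (_ + X)%E]eq_integral do rewrite /= EFinM.
  by rewrite integralZl//= cZ mule0 adde0.
by rewrite -natr1 mulrDl mul1r EFinD leeD.
Qed.

Let k2 (j : nat) : R := (j.+1%:R ^+ 2).

(* U j bounds (S n / n)^2 for all n with (j+1)^2 <= n < (j+2)^2: it splits S n at
   the square (j+1)^2, after which at most 2j+3 terms remain, and uses
   (a + b)^2 <= 2 a^2 + 2 b^2 and Cauchy-Schwarz on the remaining block. *)
Let U j w : R :=
  (2 * S (j.+1 ^ 2) w ^+ 2 +
   2 * (j.*2.+3)%:R * \sum_(i < j.*2.+3) x (j.+1 ^ 2 + i) w ^+ 2) / k2 j ^+ 2.

Let k2_gt0 j : 0 < k2 j. Proof. by rewrite exprn_gt0// ltr0n. Qed.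

Let U_ge0 j w : 0 <= U j w.
Proof.
rewrite /U divr_ge0 ?sqr_ge0// addr_ge0// mulr_ge0 ?sqr_ge0//.
by rewrite sumr_ge0// => i _; rewrite sqr_ge0.
Qed.

Let U_measurable j : measurable_fun setT (U j).
Proof.
apply: measurable_funM => //; apply: measurable_funD.
  by apply: measurable_funM => //; apply: measurable_funX.
apply: measurable_funM => //; apply: measurable_sum => i.
exact: measurable_funX.
Qed.

Let C_ge0 : 0 <= C.
Proof.
rewrite -lee_fin; apply: le_trans (bx 0); apply: integral_ge0 => w _.
by rewrite lee_fin sqr_ge0.
Qed.

(* 20 = 2 + 2 * 3^2: the first term has integral at most 2 (j+1)^2 C, and the block
   has 2j+3 <= 3 (j+1) terms. *)
Let U_integral j : (\int[P]_w (U j w)%:E <= (20 * C / k2 j)%:E)%E.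
Proof.
set N := j.*2.+3; set K := (j.+1 ^ 2)%N.
have UE w : (U j w)%:E = ((k2 j ^- 2)%:E * (2%:E * (S K w ^+ 2)%:E +
   (2 * N%:R)%:E * \sum_(i < N) (x (K + i) w ^+ 2)%:E))%E.
  by rewrite sumEFin -!EFinM mulrC.
under eq_integral do rewrite UE.
have mx2 i : measurable_fun setT (fun w => (x i w ^+ 2)%:E).
  by apply/measurable_EFinP; exact: measurable_funX.
have mS2 : measurable_fun setT (fun w => (S K w ^+ 2)%:E).
  by apply/measurable_EFinP; exact: measurable_funX.
have msum : measurable_fun setT (fun w => (\sum_(i < N) (x (K + i) w ^+ 2)%:E)%E).
  exact: emeasurable_sum.
have sum0 w : (0 <= \sum_(i < N) (x (K + i) w ^+ 2)%:E)%E.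
  by apply: sume_ge0 => i _; rewrite lee_fin sqr_ge0.
have S20 w : (0 <= (S K w ^+ 2)%:E)%E by rewrite lee_fin sqr_ge0.
rewrite ge0_integralZl//; last 3 first.
- by apply: emeasurable_funD; exact: measurable_funeM.
- by move=> w _; rewrite adde_ge0// mule_ge0// lee_fin mulr_ge0.
- by rewrite lee_fin invr_ge0 sqr_ge0.
rewrite ge0_integralD//; last 4 first.
- by move=> w _; rewrite mule_ge0.
- exact: measurable_funeM.
- by move=> w _; rewrite mule_ge0// lee_fin mulr_ge0.
- exact: measurable_funeM.
rewrite !ge0_integralZl//.
rewrite ge0_integral_sum//; last by move=> i w _; rewrite lee_fin sqr_ge0.
have b1 : (2%:E * \int[P]_w (S K w ^+ 2)%:E <= (2 * (K%:R * C))%:E)%E.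
  by rewrite EFinM; apply: (@lee_wpmul2l R 2%:E) => //; have [] := orthogonal_sum_sqr K.
have b2 : ((2 * N%:R)%:E * \sum_(i < N) \int[P]_w (x (K + i) w ^+ 2)%:E <=
    (2 * N%:R * (N%:R * C))%:E)%E.
  rewrite [leRHS]EFinM; apply: (@lee_wpmul2l R (2 * N%:R)%:E).
    by rewrite lee_fin mulr_ge0.
  apply: (@le_trans _ _ (\sum_(i < N) C%:E)%E).
    by apply: lee_sum => i _; exact: bx.
  by rewrite sumEFin sumr_const card_ord mulr_natl.
apply: le_trans (@lee_wpmul2l R (k2 j ^- 2)%:E _ _ _ (leeD b1 b2)) _.
  by rewrite lee_fin invr_ge0 sqr_ge0.
rewrite -EFinD -EFinM lee_fin.
have KE : K%:R = k2 j by rewrite /K natrX.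
have -> : 20 * C / k2 j = k2 j ^- 2 * (20 * C * k2 j).
  by have := k2_gt0 j; set t := k2 j => t0; field; rewrite gt_eqF.
rewrite ler_wpM2l ?invr_ge0 ?sqr_ge0// KE.
have Nle : N%:R <= 3 * (j.+1%:R : R).
  by rewrite -natrM ler_nat /N -addnn; lia.
have N2 : N%:R * N%:R <= 9 * k2 j.
  rewrite /k2; have : (0 : R) <= N%:R by []. nra.
have -> : 2 * (k2 j * C) + 2 * N%:R * (N%:R * C) =
  (2 * k2 j + 2 * (N%:R * N%:R)) * C by ring.
have -> : 20 * C * k2 j = (20 * k2 j) * C by ring.
rewrite ler_wpM2r//; lra.
Qed.

(* The right-hand side has increments 2 / ((N+1) (N+2)) >= 1 / (N+1)^2. *)
Let sum_inv_sqr N : \sum_(0 <= j < N) (k2 j)^-1 <= 2 - 2 / N.+1%:R.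
Proof.
elim: N => [|N IH]; first by rewrite big_geq// divr1 subrr.
rewrite big_nat_recr//=; apply: le_trans (lerD IH (lexx _)) _.
rewrite /k2; set t : R := N.+1%:R; have t0 : 0 < t by rewrite ltr0n.
have -> : N.+2%:R = t + 1 :> R by rewrite natr1.
have tp : 0 < t + 1 by rewrite addr_gt0.
rewrite -subr_ge0.
have -> : 2 - 2 / (t + 1) - (2 - 2 / t + t ^- 2) =
   (t - 1) / (t ^+ 2 * (t + 1)) by field; rewrite !gt_eqF.
apply: divr_ge0; first by rewrite subr_ge0 ler1n.
by rewrite mulr_ge0 ?sqr_ge0// ltW.
Qed.

(** The expectations of the [U j] have a finite sum, so almost surely the [U j]
    have a finite sum and tend to zero. *)
Lemma orthogonal_slln : {ae P, forall w,
  (fun n => n%:R^-1 * \sum_(i < n) x i w) @ \oo --> (0 : R)}.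
Proof.
have fin : (\int[P]_w (\sum_(j <oo) (U j w)%:E) < +oo)%E.
  rewrite integral_nneseries//; last 2 first.
  - by move=> j; apply/measurable_EFinP.
  - by move=> j w _; rewrite lee_fin.
  apply: (@le_lt_trans _ _ (40 * C)%:E); last exact: ltry.
  apply: lime_le.
    by apply: is_cvg_nneseries => j _ _; apply: integral_ge0 => w _; rewrite lee_fin.
  apply: nearW => N.
  apply: (@le_trans _ _ (\sum_(0 <= j < N) (20 * C / k2 j)%:E)%E).
    by apply: lee_sum => j _; exact: U_integral.
  rewrite sumEFin lee_fin -mulr_sumr.
  have -> : 40 * C = (20 * C) * 2 by ring.
  rewrite ler_wpM2l ?mulr_ge0//; apply: le_trans (sum_inv_sqr N) _.
  by rewrite gerBl divr_ge0.
have msum : measurable_fun setT (fun w => \sum_(j <oo) (U j w)%:E)%E.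
  by apply: ge0_emeasurable_sum => [j w _ _|j _]; [rewrite lee_fin|apply/measurable_EFinP].
have : P.-integrable setT (fun w => \sum_(j <oo) (U j w)%:E)%E.
  apply/integrableP; split => //.
  rewrite (eq_integral (fun w => \sum_(j <oo) (U j w)%:E)%E)// => w _.
  by rewrite gee0_abs// nneseries_ge0// => j _ _; rewrite lee_fin.
move=> /(integrable_ae measurableT).
apply: filterS => w /(_ Logic.I) Ufin.
have Ucvg : (fun j => U j w) @ \oo --> (0 : R).
  apply: cvg_series_cvg_0; apply: nnseries_is_cvg => // .
  by move: Ufin; rewrite fin_numE => /andP[_ /eqP h]; rewrite ltey; apply/eqP.
apply/cvgrPdist_lt => e e0.
have e2 : 0 < e ^+ 2 by rewrite exprn_gt0.
have /cvgrPdist_lt/(_ _ e2)[J _ HJ] := Ucvg.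
exists (J.+1 ^ 2)%N => // n /= Jn.
(* k+1 is the integer square root of n. *)
have [k [Jk kn nk]] : exists k, [/\ (J <= k)%N, (k.+1 ^ 2 <= n)%N & (n < k.+2 ^ 2)%N].
  have ex0 : exists k, (k.+1 ^ 2 <= n)%N by exists J.
  have ub k : (k.+1 ^ 2 <= n)%N -> (k <= n)%N.
    by move=> h; apply: leq_trans h; rewrite expnS expn1; nia.
  case: (ex_maxnP ex0 ub) => k kn kmax; exists k; split => //; first exact: kmax.
  by rewrite ltnNge; apply/negP => /kmax; rewrite ltnn.
have := HJ k Jk; rewrite /= sub0r normrN ger0_norm// => Uk.
rewrite sub0r normrN.
have n0 : (0 < n)%N by apply: leq_trans kn; rewrite expn_gt0.
have kR : k2 k <= n%:R by rewrite /k2 -natrX ler_nat.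
rewrite -(@ltr_pXn2r _ 2) ?nnegrE ?(ltW e0)//; apply: le_lt_trans Uk.
rewrite real_normK ?num_real// exprMn exprVn.
set K := (k.+1 ^ 2)%N; set N := k.*2.+3.
have KnN : (n - K <= N)%N.
  by move: nk; rewrite /N /K !expnS !expn0; lia.
have sumD (F : nat -> R) a b :
    \sum_(i < a + b) F i = \sum_(i < a) F i + \sum_(i < b) F (a + i)%N.
  by rewrite big_split_ord.
have SD : \sum_(i < n) x i w = S K w + \sum_(i < n - K) x (K + i) w.
  by have := sumD (fun i => x i w) K (n - K)%N; rewrite subnKC.
have block : (\sum_(i < n - K) x (K + i) w) ^+ 2 <=
    N%:R * \sum_(i < N) x (K + i) w ^+ 2.
  have := cauchy_schwarz (\col_(i < n - K) x (K + i)%N w) (const_mx 1).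
  rewrite -(@ler_pXn2r _ 2) ?nnegrE ?mulr_ge0 ?norm2_ge0//.
  rewrite real_normK ?num_real// exprMn !norm2_sqr !dotvE.
  under eq_bigr do rewrite !mxE mulr1.
  under [X in _ <= X * _]eq_bigr do rewrite !mxE -expr2.
  under [X in _ <= _ * X]eq_bigr do rewrite !mxE mulr1.
  rewrite sumr_const card_ord -mulr_natl mulr1 => /le_trans; apply.
  rewrite mulrC ler_pM ?ler_nat//; first by apply: sumr_ge0 => i _; exact: sqr_ge0.
  have := sumD (fun i => x (K + i)%N w ^+ 2) (n - K)%N (N - (n - K))%N.
  rewrite subnKC// => ->; rewrite lerDl.
  by apply: sumr_ge0 => i _; exact: sqr_ge0.
rewrite SD mulrC /U -/K -/N.
apply: ler_pM.
- exact: sqr_ge0.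
- by rewrite invr_ge0 sqr_ge0.
- move: block; set a := S K w; set b := \sum_(i < _) x _ w.
  set c := \sum_(i < N) _ => block; rewrite -[leRHS]/(2 * a ^+ 2 + 2 * N%:R * c).
  have := sqr_ge0 (a - b); rewrite sqrrB sqrrD -mulrA; lra.
- by rewrite lef_pV2 ?posrE ?exprn_gt0 ?ltr0n// ler_pXn2r ?nnegrE// ltW.
Qed.

End orthogonal.
End slln.

(** * Orthogonality of conditionally centered variables *)

Section orthogonality.
Context d (T : measurableType d) (R : realType) (P : probability T R).
Variable G : set (set T).
Hypothesis G_sub : <<s G >> `<=` measurable.

Local Notation TG := (g_sigma_algebraType G).

Lemma measurable_fun_g_sigma (W : T -> R) :
  measurable_fun (setT : set TG) (W : TG -> R) <->
  preimage_set_system setT W measurable `<=` <<s G >>.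
Proof.
split=> [mW _ [Y mY <-]|WG _ Y mY]; first exact: mW.
by apply: WG; exists Y.
Qed.

Lemma measurable_fun_sub_g_sigma (W : T -> R) :
  measurable_fun (setT : set TG) (W : TG -> R) -> measurable_fun setT W.
Proof. by move=> mW _ Y mY; apply: G_sub; exact: mW. Qed.

Section centered.
Variable Z : T -> R.
Hypothesis iZ : P.-integrable setT (EFin \o Z).
Hypothesis Z0 : forall A, <<s G >> A -> (\int[P]_(w in A) (Z w)%:E = 0)%E.

Let mZ : measurable_fun setT Z.
Proof. by have /integrableP[/measurable_EFinP] := iZ. Qed.

Import HBNNSimple.

(** A simple function is a finite combination of indicators of sets of the
    sub-sigma-algebra, on each of which [Z] integrates to zero. *)
Lemma integral_nnsfun_centered (h : {nnsfun TG >-> R}) :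
  (\int[P]_w ((h w : R) * Z w)%:E = 0)%E.
Proof.
pose s := fset_set (range h).
pose A (i : 'I_#|`s|) : set T := h @^-1` [set s`_i].
have AG i : <<s G >> (A i) by exact: (measurable_funPTI h).
have hE w : ((h w : R) * Z w)%:E = (\sum_(i < #|`s|) (s`_i)%:E * ((EFin \o Z) \_ (A i)) w)%E.
  rewrite (fimfunEord h w) mulr_suml -sumEFin; apply: eq_bigr => i _.
  rewrite patchE indicE -/(A i); case: ifP => wA.
    by rewrite mulr1.
  by rewrite mulr0 mul0r mule0.
have iA i : P.-integrable setT ((EFin \o Z) \_ (A i)).
  apply/(integrable_mkcond _ (G_sub (AG i))).1.
  exact: (integrableS measurableT (G_sub (AG i)) (@subsetT _ _) iZ).
under eq_integral do rewrite hE.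
rewrite integral_sum//; last by move=> i; exact: integrableZl.
rewrite big1// => i _; rewrite integralZl// -integral_mkcond Z0 ?mule0//.
Qed.

Lemma integral_ge0_centered (W : T -> R) :
  measurable_fun (setT : set TG) (W : TG -> R) -> (forall w, 0 <= W w) ->
  P.-integrable setT (EFin \o (fun w => W w * Z w)) ->
  (\int[P]_w (W w * Z w)%:E = 0)%E.
Proof.
move=> mW W0 iWZ.
have mW' : measurable_fun (setT : set TG) (EFin \o (W : TG -> R)).
  exact/measurable_EFinP.
pose h := nnsfun_approx measurableT mW'.
have hcvg w : (fun n => h n w : R) @ \oo --> W w.
  have : EFin \o (fun n => h n w : R) @ \oo --> (W w)%:E.
    by apply: cvg_nnsfun_approx => // x _; rewrite lee_fin.
  by move/fine_cvgP => [_].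
have hle n w : (h n w : R) <= W w.
  have hnd : nondecreasing_seq (fun n => h n w : R).
    by move=> a b ab; have /lefP := nd_nnsfun_approx measurableT mW' ab.
  have := nondecreasing_cvgn_le hnd (cvgP _ (hcvg w)) n.
  by rewrite (cvg_lim _ (hcvg w)).
have dc : (\int[P]_w ((h n w : R) * Z w)%:E)%E @[n --> \oo] -->
    (\int[P]_w (W w * Z w)%:E)%E.
  have [] // := @dominated_convergence _ T R P setT measurableT
    (fun n w => ((h n w : R) * Z w)%:E) (fun w => (W w * Z w)%:E)
    (fun w => `|(W w * Z w)%:E|%E).
  - move=> n; apply/measurable_EFinP; apply: measurable_funM => //.
    exact: measurable_fun_sub_g_sigma.
  - have /integrableP[] := iWZ; by [].
  - apply: aeW => w _; apply: cvg_EFin; first by apply: nearW.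
    exact: cvgM (hcvg w) (cvg_cst _).
  - by have := integrable_abse iWZ.
  - apply: aeW => w n _; rewrite lee_fin !normrM ler_wpM2r//.
    by rewrite !ger0_norm//; exact: fun_ge0.
have hz : (fun n => \int[P]_w ((h n w : R) * Z w)%:E)%E = cst 0%E.
  by apply/funext => n; exact: integral_nnsfun_centered.
move: dc; rewrite hz => dc.
exact: (cvg_unique _ dc (cvg_cst _)).
Qed.

(** A variable with zero conditional expectation is orthogonal to every variable
    that is measurable with respect to the sub-sigma-algebra, as soon as the
    product is integrable. Simple functions reach nonnegative [W] by dominated
    convergence with majorant [|W Z|]; positive and negative parts do the
    rest. *)
Lemma integral_centered (W : T -> R) :
  measurable_fun (setT : set TG) (W : TG -> R) ->
  P.-integrable setT (EFin \o (fun w => W w * Z w)) ->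
  (\int[P]_w (W w * Z w)%:E = 0)%E.
Proof.
move=> mW iWZ.
pose Wp w := Num.max (W w) 0; pose Wn w := Num.max (- W w) 0.
have WE w : W w = Wp w - Wn w.
  by rewrite /Wp /Wn /Num.max; do 2 case: ifPn; rewrite -?leNgt; lra.
have mWp : measurable_fun (setT : set TG) (Wp : TG -> R).
  exact: measurable_maxr.
have mWn : measurable_fun (setT : set TG) (Wn : TG -> R).
  by apply: measurable_maxr => //; exact: measurableT_comp.
have part (V : T -> R) : measurable_fun (setT : set TG) (V : TG -> R) ->
    (forall w, 0 <= V w <= `|W w|) ->
    P.-integrable setT (EFin \o (fun w => V w * Z w)) /\
    (\int[P]_w (V w * Z w)%:E = 0)%E.
  move=> mV VW.
  have iVZ : P.-integrable setT (EFin \o (fun w => V w * Z w)).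
    apply: (le_integrable measurableT _ _ iWZ).
      apply/measurable_EFinP; apply: measurable_funM => //.
      exact: measurable_fun_sub_g_sigma.
    move=> w _; rewrite /= lee_fin !normrM ler_wpM2r//.
    by have /andP[V0 VWw] := VW w; rewrite ger0_norm.
  split => //; apply: integral_ge0_centered => // w.
  by have /andP[] := VW w.
have [iWp Wp0] : P.-integrable setT (EFin \o (fun w => Wp w * Z w)) /\
    (\int[P]_w (Wp w * Z w)%:E = 0)%E.
  apply: part => // w.
  by rewrite /Wp le_max lexx orbT ge_max ler_norm normr_ge0.
have [iWn Wn0] : P.-integrable setT (EFin \o (fun w => Wn w * Z w)) /\
    (\int[P]_w (Wn w * Z w)%:E = 0)%E.
  apply: part => // w.
  by rewrite /Wn le_max lexx orbT ge_max normr_ge0 -normrN ler_norm.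
have E w : (W w * Z w)%:E = ((Wp w * Z w)%:E - (Wn w * Z w)%:E)%E.
  by rewrite -EFinB -mulrBl -WE.
under eq_integral do rewrite E.
by rewrite integralB//= Wp0 Wn0 sube0.
Qed.

End centered.
End orthogonality.

(** * Limits and measurability of matrix-valued functions *)

Section matrix_limits.
Context {R : realType}.

Lemma cvg_mx_entries p q (f : nat -> 'M[R]_(p, q)) (M : 'M[R]_(p, q)) :
  (forall i j, (fun k => f k i j) @ \oo --> M i j) -> f @ \oo --> M.
Proof.
move=> fM; apply/cvgrPdist_lt => e e0.
have : \forall k \near \oo, forall i j, `|M i j - f k i j| < e.
  apply: filter_forall => i; apply: filter_forall => j.
  by move: (fM i j) => /cvgrPdist_lt/(_ _ e0).
apply: filterS => k H; rewrite [X in X < _]/Num.norm/= mx_normrE.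
by apply/bigmax_ltP; split => // ij _; rewrite !mxE.
Qed.

Lemma cvg_entry p q (f : nat -> 'M[R]_(p, q)) (M : 'M[R]_(p, q)) i j :
  f @ \oo --> M -> (fun k => f k i j) @ \oo --> M i j.
Proof.
move=> fM.
apply: (@continuous_cvg _ _ _ _ _ f (fun A : 'M[R]_(p, q) => A i j) M) => //.
exact: coord_continuous.
Qed.

Lemma continuous_entry n p q (g : 'cV[R]_n -> 'M[R]_(p, q)) i j :
  continuous g -> continuous (fun x => g x i j).
Proof.
move=> cg x.
apply: (@continuous_cvg _ _ _ _ (nbhs_filter x) g
  (fun A : 'M[R]_(p, q) => A i j) (g x)).
  exact: coord_continuous.
exact: cg.
Qed.

Lemma cvg_norm2P n (f : nat -> 'cV[R]_n) (l : 'cV[R]_n) :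
  (fun k => norm2 (f k - l)) @ \oo --> (0 : R) <-> f @ \oo --> l.
Proof.
split=> [h|h].
  apply: cvg_mx_entries => i j; rewrite ord1.
  apply/cvgrPdist_lt => e e0; move/cvgrPdist_lt : h => /(_ _ e0).
  apply: filterS => k; rewrite sub0r normrN ger0_norm ?norm2_ge0//.
  apply: le_lt_trans; rewrite distrC.
  by have := normr_le_norm2 (f k - l) i; rewrite !mxE.
have s : (fun k => n%:R * `|l - f k|) @ \oo --> (0 : R).
  have -> : (0 : R) = n%:R * `|l - l| by rewrite subrr normr0 mulr0.
  by apply: cvgMr; apply: cvg_norm; apply: cvgB => //; exact: cvg_cst.
apply: (squeeze_cvgr _ (cvg_cst (0 : R)) s).
apply: nearW => k; rewrite norm2_ge0/= distrC.
apply: le_trans (norm2_le_sum _) _.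
rewrite mulr_natl -[n in _ *+ n]card_ord -sumr_const; apply: ler_sum => i _.
rewrite [leRHS]/Num.norm/= mx_normrE.
exact: (@le_bigmax _ _ _ 0 (fun ij : 'I_n * 'I_1 => `|(f k - l) ij.1 ij.2|) (i, 0)).
Qed.

End matrix_limits.

Section matrix_measurability.
Context d (T : measurableType d) (R : realType).

Definition measurable_mx p q (X : T -> 'M[R]_(p, q)) : Prop :=
  forall i j, measurable_fun setT (fun w => X w i j).

Lemma measurable_mulmx p q r (X : T -> 'M[R]_(p, q)) (Y : T -> 'M[R]_(q, r)) :
  measurable_mx X -> measurable_mx Y -> measurable_mx (fun w => X w *m Y w).
Proof.
move=> mX mY i j; under eq_fun do rewrite mxE.
by apply: measurable_sum => k; exact: measurable_funM.
Qed.

Lemma measurable_det p (X : T -> 'M[R]_p) :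
  measurable_mx X -> measurable_fun setT (fun w => \det (X w)).
Proof.
move=> mX; rewrite /determinant; apply: measurable_sum => s.
by apply: measurable_funM => //; apply: measurable_prod => i _; exact: mX.
Qed.

(** The inverse, extended by zero at zero, is the pointwise limit of the
    continuous functions [x / (x^2 + 1/(n+1))]. *)
Lemma measurable_fun_invr : measurable_fun setT (@GRing.inv R).
Proof.
apply: (@measurable_fun_cvg _ _ R setT
  (fun n (x : R) => x * (x ^+ 2 + n.+1%:R^-1)^-1)) => [n|x _].
  apply: continuous_measurable_fun => x.
  apply: cvgM; first exact: cvg_id.
  apply: cvgV; first by rewrite gt_eqF// ltr_wpDl// sqr_ge0.
  by apply: cvgD; [exact: exprn_continuous|exact: cvg_cst].
have [->|x0] := eqVneq x 0.
  by rewrite invr0; under eq_fun do rewrite mul0r; exact: cvg_cst.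
have -> : x^-1 = x * (x ^+ 2 + 0)^-1 by field.
apply: cvgM; first exact: cvg_cst.
apply: cvgV; first by rewrite addr0 sqrf_eq0.
by apply: cvgD; [exact: cvg_cst|exact: cvg_harmonic].
Qed.

Lemma measurable_invmx p (X : T -> 'M[R]_p) :
  (forall w, X w \in unitmx) -> measurable_mx X ->
  measurable_mx (fun w => invmx (X w)).
Proof.
move=> uX mX i j.
have E w : invmx (X w) i j = (\det (X w))^-1 * cofactor (X w) j i.
  by rewrite /invmx uX !mxE.
under eq_fun do rewrite E.
apply: measurable_funM.
  by apply: (measurableT_comp measurable_fun_invr); exact: measurable_det.
apply: measurable_funM => //; apply: measurable_det => a b.
by under eq_fun do rewrite !mxE; exact: mX.
Qed.

Lemma measurable_block_mx p1 p2 q1 q2 (A : T -> 'M[R]_(p1, q1))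
    (B : T -> 'M[R]_(p1, q2)) (C : T -> 'M[R]_(p2, q1)) (D : T -> 'M[R]_(p2, q2)) :
  measurable_mx A -> measurable_mx B -> measurable_mx C -> measurable_mx D ->
  measurable_mx (fun w =>
    block_mx (A w) (B w) (C w) (D w) : 'M[R]_(p1 + p2, q1 + q2)).
Proof.
move=> mA mB mC mD i j.
under eq_fun do rewrite !mxE.
case: (fintype.split i) => i'; under eq_fun do rewrite !mxE;
  case: (fintype.split j) => j'.
- exact: mA.
- exact: mB.
- exact: mC.
- exact: mD.
Qed.

(* The points of R^n with coordinates in (1/(N+1)) Z, and the coordinates of the
   grid point just below x. *)
Let grid n (N : nat) (z : 'cV[int]_n) : 'cV[R]_n := \col_i ((z i 0)%:~R / N.+1%:R).

Let rounding n (N : nat) (x : 'cV[R]_n) : 'cV[int]_n :=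
  \col_i Num.floor (x i 0 * N.+1%:R).

(** Measurability of a matrix is that of its entries, so preimages of open sets
    of [R^n] need an argument: rounding to a grid makes the composite take
    countably many values, each on a measurable set, and continuity recovers it
    as the limit for finer and finer grids. *)
Lemma measurable_continuous_comp n (X : T -> 'cV[R]_n) (g : 'cV[R]_n -> R) :
  continuous g -> measurable_mx X -> measurable_fun setT (g \o X).
Proof.
move=> cg mX.
apply: (@measurable_fun_cvg _ _ _ _
  (fun N w => g (grid N (rounding N (X w))))) => [N|w _].
  move=> _ Y mY; rewrite setTI.
  pose B (z : 'cV[int]_n) : set T := [set w | forall i, rounding N (X w) i 0 = z i 0].
  pose cell (t : int) : interval R := `[t%:~R, (t + 1)%:~R[.
  have mB z : measurable (B z).
    have -> : B z = \bigcap_(i in [set: 'I_n])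
        (fun w => X w i 0 * N.+1%:R) @^-1` [set` cell (z i 0)].
      apply/seteqP; split => w /=.
        by move=> h i _ /=; rewrite in_itv/= -floor_eq -(h i) mxE.
      by move=> h i; have := h i Logic.I; rewrite /= in_itv/= -floor_eq mxE => /eqP.
    apply: fin_bigcap_measurable => // i _; rewrite -[X in measurable X]setTI.
    exact: measurable_funM.
  have -> : (fun w => g (grid N (rounding N (X w)))) @^-1` Y =
      \bigcup_z (if `[< Y (g (grid N z)) >] then B z else set0).
    apply/seteqP; split => w /=.
      by move=> Yw; exists (rounding N (X w)) => //; rewrite asboolT.
    move=> [z _]; case: asboolP => // Yz Bz.
    suff -> : rounding N (X w) = z by [].
    by apply/matrixP => i j; rewrite ord1; exact: Bz.
  apply: countable_bigcupT_measurable => // z; by case: ifP.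
apply: (@continuous_cvg _ _ _ _ _
  (fun N => grid N (rounding N (X w))) g (X w)) => //; first exact: cg.
apply: cvg_mx_entries => i j; rewrite ord1.
have E N : grid N (rounding N (X w)) i 0 =
    (Num.floor (X w i 0 * N.+1%:R))%:~R / N.+1%:R by rewrite !mxE.
under eq_fun do rewrite E.
have low : (fun N : nat => X w i 0 - N.+1%:R^-1) @ \oo --> X w i 0.
  rewrite -[X in _ --> X]subr0; apply: cvgB; first exact: cvg_cst.
  exact: cvg_harmonic.
apply: (squeeze_cvgr _ low (cvg_cst (X w i 0))).
apply: nearW => N.
have N0 : (0 : R) < N.+1%:R by rewrite ltr0n.
rewrite ler_pdivrMr// floor_le andbT ler_pdivlMr// mulrBl mulVf ?gt_eqF//.
by rewrite lerBlDr -intrD1 ltW// floorD1_gt.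
Qed.

End matrix_measurability.

(** * The multiplier noise of the stochastic algorithm *)

Section sqp_noise.
Context {R : realType} {n m : nat} d (T : measurableType d) (P : probability T R).
Variables (f : 'cV[R]_n -> R) (c : 'cV[R]_n -> 'cV[R]_m).
Variables (x1 : 'cV[R]_n) (alpha : nat -> R).
Variables (X G D Dtrue : nat -> T -> 'cV[R]_n) (Y Ytrue : nat -> T -> 'cV[R]_m).
Variables (H : nat -> T -> 'M[R]_n) (F1 : set (set T)).
Hypothesis c_cont : continuous c.
Hypothesis gradc_cont : continuous (gradc c).
Hypothesis F1_sub : F1 `<=` measurable.
Hypothesis X_init : forall w, X 1%N w = x1.
Hypothesis X_step : forall k w, (0 < k)%N ->
  X k.+1 w = X k w + alpha k *: D k w.
Hypothesis DY_solve : forall k w, (0 < k)%N ->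
  newton_system c (X k w) (G k w) (H k w) (D k w) (Y k w).
Hypothesis DYtrue_solve : forall k w, (0 < k)%N ->
  newton_system c (X k w) (grad f (X k w)) (H k w) (Dtrue k w) (Ytrue k w).
Hypothesis G_measurable : forall k, (0 < k)%N -> measurable_wrt measurable (G k).
Hypothesis H_measurable : forall k, (0 < k)%N ->
  measurable_wrt (history F1 G k) (H k).
Hypothesis G_unbiased : forall k, (0 < k)%N ->
  is_cond_exp_mx P (history F1 G k) (G k) (fun w => grad f (X k w)).
Variable sigma : R.
Hypothesis G_sqr_integrable : forall k, (0 < k)%N -> P.-integrable setT
  (EFin \o (fun w => norm2 (G k w - grad f (X k w)) ^+ 2)).
Hypothesis G_variance : forall k, (0 < k)%N ->
  (\int[P]_w (norm2 (G k w - grad f (X k w)) ^+ 2)%:E <= (sigma ^+ 2)%:E)%E.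
Variables s0 kappa zeta : R.
Hypotheses (s0_gt0 : 0 < s0) (kappa_gt0 : 0 < kappa) (zeta_gt0 : 0 < zeta).
Hypothesis gradc_low : forall k w (y : 'cV[R]_m), (0 < k)%N ->
  s0 * norm2 y <= norm2 (gradc c (X k w) *m y).
Hypothesis H_up : forall k w (u : 'cV[R]_n), (0 < k)%N ->
  norm2 (H k w *m u) <= kappa * norm2 u.
Hypothesis H_coercive : forall k w (u : 'cV[R]_n), (0 < k)%N ->
  (gradc c (X k w))^T *m u = 0 -> zeta * norm2 u ^+ 2 <= dotv u (H k w *m u).

Let gen k : set (set T) :=
  F1 `|` \bigcup_(i in [set i | (0 < i < k)%N]) \bigcup_(j in [set: 'I_n])
         preimage_set_system setT (fun w => G i w j 0) measurable.

Let history_sub k : history F1 G k `<=` measurable.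
Proof.
apply: smallest_sub; first exact: sigma_algebra_measurable.
move=> A [/F1_sub//|[i /andP[i0 _] [j _ GA]]].
exact: (G_measurable i0 GA).
Qed.

Let history_mono k l : (k <= l)%N -> history F1 G k `<=` history F1 G l.
Proof.
move=> kl; apply: sub_sigma_algebra2 => A [F1A|[i /andP[i0 ik] h]]; first by left.
by right; exists i => //=; rewrite i0 (leq_trans ik).
Qed.

(** Measurability with respect to the history is expressed over the type that
    carries this sigma-algebra, so that closure properties of measurable
    functions apply to it. *)
Definition adapted p q k (V : T -> 'M[R]_(p, q)) : Prop :=
  @measurable_mx _ (g_sigma_algebraType (gen k)) R p q V.

Lemma adaptedP p q k (V : T -> 'M[R]_(p, q)) :
  adapted k V <-> measurable_wrt (history F1 G k) V.
Proof.
by split=> h i j; have := h i j => /(measurable_fun_g_sigma (gen k)).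
Qed.

Lemma adapted_mono p q k l (V : T -> 'M[R]_(p, q)) :
  (k <= l)%N -> adapted k V -> adapted l V.
Proof.
move=> kl /adaptedP mV; apply/adaptedP => i j.
exact: subset_trans (mV i j) (history_mono kl).
Qed.

Lemma adapted_G k l : (0 < k < l)%N -> adapted l (G k).
Proof.
move=> kl; apply/adaptedP => i j A hA; rewrite ord1 in hA.
by apply: sub_sigma_algebra; right; exists k => //; exists i.
Qed.

Let K k w := saddle_mx (H k w) (gradc c (X k w)).

Let K_unit k w : (0 < k)%N -> K k w \in unitmx.
Proof.
move=> k0; apply: (@saddle_unit _ _ _ _ _ s0 kappa zeta) => // u.
- exact: gradc_low.
- exact: H_up.
- exact: H_coercive.
Qed.

Lemma adapted_K k : (0 < k)%N -> adapted k (X k) ->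
  adapted k (fun w => invmx (K k w)).
Proof.
move=> k0 mX; apply: measurable_invmx => [w|]; first exact: K_unit.
have mA : adapted k (fun w => gradc c (X k w)).
  move=> i j; apply: (measurable_continuous_comp (g := fun x => gradc c x i j)) mX.
  exact: continuous_entry.
apply: measurable_block_mx => //.
- by apply/adaptedP; exact: H_measurable.
- by move=> i j; under eq_fun do rewrite mxE; exact: mA.
Qed.

(** [D_k] is a rational function of [H_k], [G_k] and continuous functions of [X_k],
    and all of these are known at time [k+1]. *)
Lemma adapted_X k : (0 < k)%N -> adapted k (X k).
Proof.
elim: k => // -[_ _|k IH _].
  by move=> i j; under eq_fun do rewrite X_init; exact: measurable_cst.
have k0 : (0 < k.+1)%N by [].
have mX := IH k0.
have mX' : adapted k.+2 (X k.+1) by apply: adapted_mono mX.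
have mK : adapted k.+2 (fun w => invmx (K k.+1 w)).
  by apply: adapted_mono (adapted_K k0 mX).
have DE w : D k.+1 w =
    usubmx (invmx (K k.+1 w) *m (- col_mx (G k.+1 w) (c (X k.+1 w)))).
  by rewrite -(DY_solve w k0) mulKmx ?col_mxKu//; exact: K_unit.
have mrhs : adapted k.+2 (fun w => - col_mx (G k.+1 w) (c (X k.+1 w))).
  move=> i j; under eq_fun do rewrite !mxE.
  apply: measurableT_comp => //.
  have mG : adapted k.+2 (G k.+1) by apply: adapted_G => /=.
  case: (fintype.split i) => i'; first exact: mG.
  rewrite ord1; apply: (measurable_continuous_comp (g := fun x => c x i' 0)) mX'.
  exact: continuous_entry.
have mD : adapted k.+2 (D k.+1).
  move=> i j; under eq_fun do rewrite DE mxE.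
  exact: (measurable_mulmx mK mrhs).
move=> i j; under eq_fun do rewrite X_step// !mxE.
by apply: measurable_funD; [exact: mX'|apply: measurable_funM => //; exact: mD].
Qed.

Let Delta k w := grad f (X k w) - G k w.

Let DeltaE k w i j : Delta k w i j = grad f (X k w) i j - G k w i j.
Proof. by rewrite /Delta !mxE. Qed.

(* The matrix that maps the gradient error to the multiplier error. *)
Let N k w : 'M[R]_(m, n) := dlsubmx (invmx (K k w)).

Let noise (a : 'I_m) k w : R := (Y k w - Ytrue k w) a 0.

(** The two Newton systems share their matrix, and their right-hand sides differ
    by [(Delta_k, 0)]. *)
Lemma multiplier_noiseE k w : (0 < k)%N -> Y k w - Ytrue k w = N k w *m Delta k w.
Proof.
move=> k0.
have e : K k w *m col_mx (D k w - Dtrue k w) (Y k w - Ytrue k w) =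
    col_mx (Delta k w) 0.
  have -> : col_mx (D k w - Dtrue k w) (Y k w - Ytrue k w) =
      col_mx (D k w) (Y k w) - col_mx (Dtrue k w) (Ytrue k w).
    by rewrite opp_col_mx add_col_mx.
  rewrite mulmxBr [K _ _ *m _]DY_solve// [K _ _ *m _]DYtrue_solve//.
  rewrite !opp_col_mx add_col_mx subrr opprK addrC.
  by rewrite /Delta addrC.
have := congr1 dsubmx (congr1 (mulmx (invmx (K k w))) e).
rewrite mulKmx ?K_unit// col_mxKd => ->.
rewrite -[invmx (K k w)]submxK mul_block_col !mulmx0 !addr0 col_mxKd.
by rewrite /N.
Qed.

Let B := dual_bound s0 kappa zeta.

Lemma noise_mx_bound k w (g : 'cV[R]_n) : (0 < k)%N ->
  norm2 (N k w *m g) <= B * norm2 g.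
Proof.
move=> k0.
pose z := invmx (K k w) *m col_mx g 0.
have zE : dsubmx z = N k w *m g.
  rewrite /z -[invmx (K k w)]submxK mul_block_col !mulmx0 !addr0 col_mxKd.
  by rewrite /N.
have : K k w *m col_mx (usubmx z) (dsubmx z) = col_mx g 0.
  by rewrite vsubmxK /z mulKVmx ?K_unit.
rewrite saddle_mxE => /eq_col_mx[e1 e2].
have [_] := @saddle_stability _ _ _ _ _ s0 kappa zeta s0_gt0 kappa_gt0 zeta_gt0
  (fun y => gradc_low w y k0) (fun u => H_up w u k0)
  (fun u => @H_coercive k w u k0) _ _ _ _ e1 e2.
by rewrite norm20 addr0 zE.
Qed.

Let B_ge0 : 0 <= B. Proof. exact: dual_bound_ge0. Qed.

Let adapted_grad k : (0 < k)%N -> adapted k (fun w => grad f (X k w)).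
Proof. by move=> k0; apply/adaptedP => i j; have [] := G_unbiased k0 i j. Qed.

Let adapted_Delta k l : (0 < k < l)%N -> adapted l (Delta k).
Proof.
move=> kl; have /andP[k0 kl'] := kl.
have mg := adapted_mono (ltnW kl') (adapted_grad k0).
have mG := adapted_G kl.
move=> i j; under eq_fun do rewrite DeltaE.
exact: measurable_funB (mg i j) (mG i j).
Qed.

Let adapted_N k : (0 < k)%N -> adapted k (N k).
Proof.
move=> k0 i j; under eq_fun do rewrite !mxE.
exact: (adapted_K k0 (adapted_X k0) (rshift n i) (lshift m j)).
Qed.

Let measurable_adapted k (V : T -> R) :
  measurable_fun (setT : set (g_sigma_algebraType (gen k)))
    (V : g_sigma_algebraType (gen k) -> R) ->
  measurable_fun setT V.
Proof. exact: (measurable_fun_sub_g_sigma (@history_sub k)). Qed.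

Let noiseE a k w : (0 < k)%N ->
  noise a k w = \sum_(b < n) N k w a b * Delta k w b 0.
Proof. by move=> k0; rewrite /noise multiplier_noiseE// mxE. Qed.

Let noise_measurable a k l : (0 < k < l)%N -> measurable_fun
  (setT : set (g_sigma_algebraType (gen l)))
  (noise a k : g_sigma_algebraType (gen l) -> R).
Proof.
move=> kl; have /andP[k0 /ltnW kl'] := kl.
have -> : noise a k = fun w => \sum_(b < n) N k w a b * Delta k w b 0.
  by apply/funext => w; exact: noiseE.
apply: measurable_sum => b; apply: measurable_funM.
  exact: (adapted_mono kl' (adapted_N k0)).
exact: adapted_Delta.
Qed.

Let noise_bound a k w : (0 < k)%N -> `|noise a k w| <= B * norm2 (Delta k w).
Proof.
move=> k0; rewrite /noise multiplier_noiseE//.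
by rewrite (le_trans (normr_le_norm2 _ _))// noise_mx_bound.
Qed.

(* The entries of column b of N_k are bounded by its value at a unit vector. *)
Let N_bound a b k w : (0 < k)%N -> `|N k w a b| <= B.
Proof.
move=> k0.
have <- : (N k w *m (delta_mx b 0 : 'cV[R]_n)) a 0 = N k w a b.
  by rewrite -colE mxE.
apply: le_trans (normr_le_norm2 _ _) _.
apply: le_trans (noise_mx_bound w _ k0) _.
suff -> : norm2 (delta_mx b 0 : 'cV[R]_n) = 1 by rewrite mulr1.
apply/eqP; rewrite -(@eqrXn2 _ 2)// ?norm2_ge0// norm2_sqr dotvE expr1n.
rewrite (bigD1 b)//= big1 => [|i ib]; rewrite !mxE ?eqxx ?mulr1 ?addr0//.
by rewrite (negbTE ib) mul0r.
Qed.

Let sqr_dominated k (V : T -> R) (C : R) : (0 < k)%N ->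
  measurable_fun setT V -> (forall w, `|V w| <= C * norm2 (Delta k w)) ->
  P.-integrable setT (EFin \o (fun w => V w ^+ 2)) /\
  (\int[P]_w (V w ^+ 2)%:E <= (C ^+ 2 * sigma ^+ 2)%:E)%E.
Proof.
move=> k0 mV VC.
have DE w : norm2 (Delta k w) = norm2 (G k w - grad f (X k w)).
  by rewrite -norm2N opprB.
have iD := G_sqr_integrable k0.
have le w : V w ^+ 2 <= C ^+ 2 * norm2 (G k w - grad f (X k w)) ^+ 2.
  rewrite -DE -exprMn -real_normK ?num_real// -[leRHS]real_normK ?num_real//.
  rewrite ler_pXn2r ?nnegrE//; apply: le_trans (VC w) (ler_norm _).
have iC : P.-integrable setT (fun w => (C ^+ 2)%:E *
    (EFin \o (fun w => norm2 (G k w - grad f (X k w)) ^+ 2)%R) w)%E.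
  exact: integrableZl.
have mV2 : measurable_fun setT (EFin \o (fun w => V w ^+ 2)).
  by apply/measurable_EFinP; exact: measurable_funX.
split.
  apply: (le_integrable measurableT mV2 _ iC) => w _ /=.
  by rewrite lee_fin !ger0_norm ?(mulr_ge0 (sqr_ge0 _) (sqr_ge0 _)) ?sqr_ge0.
rewrite EFinM.
apply: le_trans (@lee_wpmul2l R (C ^+ 2)%:E _ _ _ (G_variance k0)); last first.
  by rewrite lee_fin sqr_ge0.
rewrite -ge0_integralZl//; last 3 first.
- by have /integrableP[] := iD.
- by move=> w _; rewrite lee_fin sqr_ge0.
- by rewrite lee_fin sqr_ge0.
apply: ge0_le_integral => //.
- by move=> w _; rewrite lee_fin sqr_ge0.
- by have /integrableP[] := iC.
- by move=> w _; rewrite /= -EFinM lee_fin.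
Qed.

Let Delta_centered k b A : (0 < k)%N -> history F1 G k A ->
  (\int[P]_(w in A) (Delta k w b 0)%:E = 0)%E.
Proof.
move=> k0 hA; have mA := history_sub hA.
have [iG ig _ /(_ _ hA) E] := G_unbiased k0 b 0.
have iGA := integrableS measurableT mA (@subsetT _ _) iG.
have igA := integrableS measurableT mA (@subsetT _ _) ig.
under eq_integral do rewrite DeltaE EFinB.
rewrite integralB//= -E.
  by rewrite subee// integrable_fin_num.
Qed.

Let Delta_integrable k b : (0 < k)%N ->
  P.-integrable setT (EFin \o (fun w => Delta k w b 0)).
Proof.
move=> k0; have [iG ig _ _] := G_unbiased k0 b 0.
have -> : EFin \o (fun w => Delta k w b 0) =
    ((EFin \o (fun w => grad f (X k w) b 0)%R) \-
     (EFin \o (fun w => G k w b 0)%R))%E.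
  by apply/funext => w; rewrite /= DeltaE EFinB.
exact: integrableB.
Qed.

(* The earlier noise times a row of N_j is known at time j, so it is orthogonal to
   each component of Delta_j. *)
Let noise_uncorrelated a i j : (0 < i < j)%N ->
  (\int[P]_w (noise a i w * noise a j w)%:E = 0)%E.
Proof.
move=> ij; have /andP[i0 lij] := ij; have j0 : (0 < j)%N by apply: leq_trans lij.
have E w : (noise a i w * noise a j w)%:E =
    (\sum_(b < n) (noise a i w * N j w a b * Delta j w b 0)%R%:E)%E.
  rewrite (noiseE _ _ j0) mulr_sumr sumEFin; congr EFin.
  by apply: eq_bigr => b _; rewrite mulrA.
have mW b : measurable_fun (setT : set (g_sigma_algebraType (gen j)))
    ((fun w => noise a i w * N j w a b) : g_sigma_algebraType (gen j) -> R).
  by apply: measurable_funM; [exact: noise_measurable|exact: adapted_N].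
have iW b : P.-integrable setT
    (EFin \o (fun w => noise a i w * N j w a b * Delta j w b 0)).
  have mD : measurable_fun setT (fun w => Delta j w b 0).
    by have /integrableP[/measurable_EFinP] := Delta_integrable b j0.
  apply: integrable_mul_sqr => //; first exact: measurable_adapted (mW b).
    have [] // := @sqr_dominated i (fun w => noise a i w * N j w a b) (B * B) i0.
      exact: measurable_adapted (mW b).
    move=> w; rewrite normrM mulrAC ler_pM// ?N_bound//.
    exact: noise_bound.
  have [] // := @sqr_dominated j (fun w => Delta j w b 0) 1 j0 mD.
  by move=> w; rewrite mul1r normr_le_norm2.
under eq_integral do rewrite E.
rewrite integral_sum//= big1// => b _.
apply: (integral_centered (@history_sub j) (Delta_integrable b j0)) => //.
by move=> A; exact: Delta_centered.
Qed.

Lemma multiplier_noise_slln (k0 : nat) (a : 'I_m) : (0 < k0)%N ->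
  {ae P, forall w, (fun N => N%:R^-1 *
     \sum_(i < N) (Y (k0 + i)%N w - Ytrue (k0 + i)%N w) a 0) @ \oo --> (0 : R)}.
Proof.
move=> k0_gt0.
have pos i : (0 < k0 + i)%N by rewrite addn_gt0 k0_gt0.
have mn i : measurable_fun setT (noise a (k0 + i)%N).
  apply: (@measurable_adapted (k0 + i).+1).
  by apply: noise_measurable; rewrite pos/=.
apply: (@orthogonal_slln _ _ _ _ (fun i => noise a (k0 + i)%N) (B ^+ 2 * sigma ^+ 2)) => //.
- by move=> i; have [] := sqr_dominated (pos i) (mn i) (fun w => noise_bound a w (pos i)).
- by move=> i; have [] := sqr_dominated (pos i) (mn i) (fun w => noise_bound a w (pos i)).
- by move=> i j ij; apply: noise_uncorrelated; rewrite pos ltn_add2l.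
Qed.

End sqp_noise.

(** * Convergence of the multipliers *)

(** [V] may be negative, so its positive part is what gets compared with the
    constant. *)
Lemma integral_le_cond_exp_bound {R : realType} d (T : measurableType d)
    (P : probability T R) (F : set (set T)) (X V : T -> R) (s : R) :
  is_cond_exp P F X V -> F setT -> 0 <= s -> {ae P, forall w, V w <= s} ->
  (\int[P]_w (X w)%:E <= s%:E)%E.
Proof.
move=> [_ iV _ E] FT s0 Vs; rewrite -(E _ FT).
have mV : measurable_fun setT V by have /integrableP[/measurable_EFinP] := iV.
have mVp : measurable_fun setT (fun w => Num.max (V w) 0).
  exact: measurable_maxr.
have iVp : P.-integrable setT (EFin \o (fun w => Num.max (V w) 0)).
  apply: (le_integrable measurableT _ _ iV); first exact/measurable_EFinP.
  move=> w _; rewrite /= lee_fin ger0_norm; last by rewrite le_max lexx orbT.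
  by rewrite ge_max ler_norm normr_ge0.
apply: (@le_trans _ _ (\int[P]_w (Num.max (V w) 0)%:E)%E).
  apply: (le_integral _ iV iVp) => // w _ /=.
  by rewrite lee_fin le_max lexx.
apply: (@le_trans _ _ (\int[P]_w (cst s%:E) w)%E); last first.
  by rewrite integral_cst//= probability_setT mule1.
apply: ae_ge0_le_integral => //.
- by move=> w _; rewrite lee_fin le_max lexx orbT.
- exact/measurable_EFinP.
- by apply: filterS Vs => w Vw _; rewrite /= lee_fin ge_max Vw.
Qed.

(** Subtracting the stationarity equations at [xstar] from the Newton system at
    [x] leaves a saddle-point system for [(d, y - ystar)] whose right-hand side
    consists of increments of the gradient of [f], of the gradient of [c] and of
    [c] between [xstar] and [x]. *)
Lemma multiplier_error_bound {R : realType} {n m : nat} (f : 'cV[R]_n -> R)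
    (c : 'cV[R]_n -> 'cV[R]_m) (x xstar : 'cV[R]_n) (ystar : 'cV[R]_m)
    (h : 'M[R]_n) (d : 'cV[R]_n) (y : 'cV[R]_m) (XX : set 'cV[R]_n)
    (Lf Lc Gam s0 kappa zeta : R) :
  0 < s0 -> 0 < kappa -> 0 < zeta ->
  (forall v : 'cV[R]_m, s0 * norm2 v <= norm2 (gradc c x *m v)) ->
  (forall u : 'cV[R]_n, norm2 (h *m u) <= kappa * norm2 u) ->
  (forall u : 'cV[R]_n, (gradc c x)^T *m u = 0 ->
     zeta * norm2 u ^+ 2 <= dotv u (h *m u)) ->
  XX x -> XX xstar -> lipschitz_with norm2 XX (grad f) Lf ->
  lipschitz_with norm2 XX c Lc -> lipschitz_with spectral_norm XX (gradc c) Gam ->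
  stationary_point f c xstar ystar -> newton_system c x (grad f x) h d y ->
  norm2 (y - ystar) <= dual_bound s0 kappa zeta
    * ((Lf + Gam * norm2 ystar + Lc) * norm2 (x - xstar)).
Proof.
move=> s0p kp zp low up coer xX sX lf lc lG [st cst] ns.
have : saddle_mx h (gradc c x) *m col_mx d y = - col_mx (grad f x) (c x) by exact: ns.
rewrite saddle_mxE opp_col_mx => /eq_col_mx[e1 e2].
have e1' : h *m d + gradc c x *m (y - ystar) =
    - (grad f x - grad f xstar) - (gradc c x - gradc c xstar) *m ystar.
  rewrite mulmxBr addrA e1 mulmxBl.
  have -> : grad f xstar = - (gradc c xstar *m ystar).
    by apply/eqP; rewrite -addr_eq0 st.
  by rewrite opprK opprD opprB addrA subrK.
have e2' : (gradc c x)^T *m d = - (c x - c xstar) by rewrite cst subr0.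
have [_ /le_trans] := saddle_stability s0p kp zp low up coer e1' e2'.
apply; apply: ler_wpM2l.
  exact: dual_bound_ge0.
rewrite norm2N mulrDl; apply: lerD; last exact: lc.
apply: le_trans (norm2B_le _ _) _; rewrite norm2N mulrDl; apply: lerD.
  exact: lf.
apply: le_trans (norm2_mulmx_spectral _ _) _.
by rewrite mulrAC ler_wpM2r ?norm2_ge0//; exact: lG.
Qed.

Theorem corollary4p3
  (R : realType) (n m : nat)
  (* the problem *)
  (diota : measure_display) (Tiota : measurableType diota)
  (Piota : probability Tiota R) (F : 'cV[R]_n -> Tiota -> R)
  (f : 'cV[R]_n -> R) (c : 'cV[R]_n -> 'cV[R]_m)
  (F_integrable : forall x, Piota.-integrable setT (EFin \o F x))
  (f_expectation : forall x, (f x)%:E = ('E_Piota[F x])%E)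
  (* the algorithm; indices k = 1, 2, ... *)
  (x1 : 'cV[R]_n) (Lf Gam tau xi : R) (beta alpha : nat -> R)
  (Lf_gt0 : 0 < Lf) (Gam_gt0 : 0 < Gam) (tau_gt0 : 0 < tau) (xi_gt0 : 0 < xi)
  (beta_itv : forall k, (0 < k)%N -> 0 < beta k <= 1)
  (beta_sum : (\sum_(1 <= k <oo) (beta k)%:E = +oo)%E)
  (beta_sqr_sum : (\sum_(1 <= k <oo) (beta k ^+ 2)%:E < +oo)%E)
  (alphaE : forall k, (0 < k)%N ->
     alpha k = beta k * tau * xi / (tau * Lf + Gam))
  (alpha_itv : forall k, (0 < k)%N -> 0 < alpha k <= 1)
  (P : probability (sample_paths Tiota) R)
  (X G D Dtrue : nat -> sample_paths Tiota -> 'cV[R]_n)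
  (Y Ytrue : nat -> sample_paths Tiota -> 'cV[R]_m)
  (H : nat -> sample_paths Tiota -> 'M[R]_n)
  (Z : nat -> sample_paths Tiota -> 'M[R]_(n, n - m))
  (M : nat -> sample_paths Tiota -> 'M[R]_(m, n))
  (X_init : forall w, X 1%N w = x1)
  (X_step : forall k w, (0 < k)%N -> X k.+1 w = X k w + alpha k *: D k w)
  (DY_solve : forall k w, (0 < k)%N ->
     newton_system c (X k w) (G k w) (H k w) (D k w) (Y k w))
  (DYtrue_solve : forall k w, (0 < k)%N ->
     newton_system c (X k w) (grad f (X k w)) (H k w) (Dtrue k w) (Ytrue k w))
  (Z_basis : forall k w, (0 < k)%N -> null_basis (gradc c (X k w)) (Z k w))
  (ME : forall k w, (0 < k)%N ->
     M k w = multiplier_mx (gradc c (X k w)) (H k w) (Z k w))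
  (G_component : forall k w w', (0 < k)%N ->
     (forall i, (0 < i < k)%N -> G i w = G i w') -> X k w = X k w' ->
     sample_component k w = sample_component k w' -> G k w = G k w')
  (G_measurable : forall k, (0 < k)%N -> measurable_wrt measurable (G k))
  (* initial conditions *)
  (F1 : set (set (sample_paths Tiota)))
  (F1_sigma : sigma_algebra setT F1) (F1_sub : F1 `<=` measurable)
  (* problem regularity *)
  (XX : set 'cV[R]_n)
  (problem_reg : problem_regularity f c XX)
  (X_in : forall k w, (0 < k)%N -> XX (X k w))
  (Lf_lipschitz : lipschitz_with norm2 XX (grad f) Lf)
  (Gam_lipschitz : lipschitz_with spectral_norm XX (gradc c) Gam)
  (* parameters *)
  (xi_le : forall k w, (0 < k)%N -> D k w != 0 ->
     xi <= delta_q c tau (X k w) (G k w) (H k w) (D k w)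
           / (tau * norm2 (D k w) ^+ 2))
  (nu : R) (nu_itv : 0 < nu < 1) (rho : nat -> sample_paths Tiota -> R)
  (rhoE : forall k w, (0 < k)%N ->
     rho k w = dotv (grad f (X k w)) (Dtrue k w)
               + Num.max (dotv (Dtrue k w) (H k w *m Dtrue k w)) 0)
  (tau_le : forall k w, (0 < k)%N -> 0 < rho k w ->
     tau <= (1 - nu) * norm1 (c (X k w)) / rho k w)
  (* stochastic gradients *)
  (G_unbiased : forall k, (0 < k)%N ->
     is_cond_exp_mx P (history F1 G k) (G k) (fun w => grad f (X k w)))
  (sigma : R) (sigma_gt0 : 0 < sigma)
  (G_variance : forall k, (0 < k)%N ->
     exists2 V : sample_paths Tiota -> R,
       is_cond_exp P (history F1 G k)
         (fun w => norm2 (G k w - grad f (X k w)) ^+ 2) V &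
       {ae P, forall w, V w <= sigma ^+ 2})
  (* matrices *)
  (H_sym : forall k w, (0 < k)%N -> symmetric_mx (H k w))
  (H_measurable : forall k, (0 < k)%N -> measurable_wrt (history F1 G k) (H k))
  (kappaH : R) (kappaH_gt0 : 0 < kappaH)
  (H_bounded : forall k w, (0 < k)%N -> spectral_norm (H k w) <= kappaH)
  (zeta : R) (zeta_itv : 0 < zeta <= kappaH)
  (H_coercive : forall k w (u : 'cV[R]_n), (0 < k)%N ->
     (gradc c (X k w))^T *m u = 0 ->
     zeta * norm2 u ^+ 2 <= dotv u (H k w *m u))
  (* the limit point and the local behavior of H_k and M_k *)
  (xstar : 'cV[R]_n) (ystar : 'cV[R]_m)
  (star_stationary : stationary_point f c xstar ystar) (star_in : XX xstar)
  (eps : R) (eps_gt0 : 0 < eps)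
  (HH : 'cV[R]_n -> 'M[R]_n) (HH_sym : forall x, symmetric_mx (HH x))
  (LH : R) (LH_gt0 : 0 < LH)
  (MM : 'cV[R]_n -> 'M[R]_(m, n)) (LM : R) (LM_gt0 : 0 < LM)
  (HH_eq : forall k w, (0 < k)%N -> cball2 xstar eps (X k w) ->
     H k w = HH (X k w))
  (HH_lipschitz : lipschitz_with spectral_norm (cball2 xstar eps) HH LH)
  (MM_eq : forall k w, (0 < k)%N -> cball2 xstar eps (X k w) ->
     M k w = MM (X k w))
  (MM_lipschitz : lipschitz_with spectral_norm (cball2 xstar eps) MM LM)
  (kbar : nat) (kbar_gt0 : (0 < kbar)%N)
  (X_near : {ae P, forall w, forall k, (kbar <= k)%N ->
     norm2 (X k w - xstar) <= eps})
  (Delta : nat -> sample_paths Tiota -> 'cV[R]_n)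
  (DeltaE : forall k w, (0 < k)%N -> Delta k w = grad f (X k w) - G k w)
  (cond_a : forall k i, (0 < i <= k)%N ->
     ((k%:R^-1)%:E * 'E_P[fun w => (norm2 (M i w *m Delta i w) ^+ 2)%R] < +oo)%E)
  (cond_b : forall delta : R, 0 < delta ->
     exists2 V : nat -> nat -> sample_paths Tiota -> R,
       (forall k i, (0 < i <= k)%N ->
          is_cond_exp P (history F1 G i)
            (fun w => norm2 (M i w *m Delta i w) ^+ 2 *
               \1_[set w' | delta <
                     norm2 (M i w' *m Delta i w') / Num.sqrt k%:R] w)
            (V k i)) &
       cvg_in_prob P (fun k w => k%:R^-1 * \sum_(1 <= i < k.+1) V k i w) 0)
  (Sigma : 'M[R]_m) (Sigma_sym : symmetric_mx Sigma)
  (cond_c : exists2 V : nat -> sample_paths Tiota -> 'M[R]_m,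
     (forall i, (0 < i)%N ->
        is_cond_exp_mx P (history F1 G i)
          (fun w => M i w *m Delta i w *m (Delta i w)^T *m (M i w)^T) (V i)) &
     (forall a b : 'I_m, cvg_in_prob P
        (fun k w => (k%:R^-1 *: \sum_(1 <= i < k.+1) V i w) a b) (Sigma a b)))
  (Theta : R) (Theta_gt1 : 1 < Theta)
  (cond_d : (ereal_sup [set 'E_P[fun w =>
       (norm2 (\sum_(1 <= i < k.+1)
                 (Num.sqrt k%:R)^-1 *: (M i w *m Delta i w)) `^ Theta)%R]
       | k in [set k : nat | (0 < k)%N]] < +oo)%E)
  (X_cvg : {ae P, forall w, (fun k => X k w) @ \oo --> xstar})
  (Yavg : nat -> sample_paths Tiota -> 'cV[R]_m)
  (YavgE : forall k w, (kbar <= k)%N ->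
     Yavg k w = ((k - kbar).+1)%:R^-1 *: \sum_(kbar <= i < k.+1) Y i w) :
  {ae P, forall w, ((fun k => Ytrue k w) @ \oo --> ystar) /\
                   ((fun k => Yavg k w) @ \oo --> ystar)}.
Proof.
have [s0 s0_gt0 sing] := reg_singular problem_reg.
have [Lc _ c_lip] := reg_c_lipschitz problem_reg.
have [zeta_gt0 _] := andP zeta_itv.
have low k w (y : 'cV[R]_m) : (0 < k)%N ->
    s0 * norm2 y <= norm2 (gradc c (X k w) *m y).
  move=> k0; apply: singular_value_lower_bound => // s.
  exact: (sing _ s (X_in k w k0)).
have up k w (u : 'cV[R]_n) : (0 < k)%N ->
    norm2 (H k w *m u) <= kappaH * norm2 u.
  move=> k0; apply: le_trans (norm2_mulmx_spectral _ _) _.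
  by rewrite ler_wpM2r ?norm2_ge0// H_bounded.
have Ytrue_cvg w : (fun k => X k w) @ \oo --> xstar ->
    (fun k => Ytrue k w) @ \oo --> ystar.
  move=> /cvg_norm2P Xw; apply/cvg_norm2P.
  set B := dual_bound s0 kappaH zeta.
  have lim0 : (fun k => B * ((Lf + Gam * norm2 ystar + Lc) * norm2 (X k w - xstar)))
      @ \oo --> (0 : R).
    have -> : (0 : R) = B * ((Lf + Gam * norm2 ystar + Lc) * 0) by rewrite !mulr0.
    by apply: cvgMr; apply: cvgMr.
  apply: (squeeze_cvgr _ (cvg_cst (0 : R)) lim0).
  exists 1%N => // k /= k0; rewrite norm2_ge0/=.
  apply: (@multiplier_error_bound _ _ _ f c _ _ _ (H k w) (Dtrue k w) _ XX) => //.
  - by move=> y; exact: low.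
  - by move=> u; exact: up.
  - by move=> u; exact: H_coercive.
  - exact: X_in.
  - exact: DYtrue_solve.
have slln a : {ae P, forall w, (fun N => N%:R^-1 *
     \sum_(i < N) (Y (kbar + i)%N w - Ytrue (kbar + i)%N w) a 0) @ \oo --> (0 : R)}.
  apply: (@multiplier_noise_slln _ _ _ _ _ P f c x1 alpha X G D Dtrue Y Ytrue H F1
    _ _ F1_sub X_init X_step DY_solve DYtrue_solve G_measurable H_measurable
    G_unbiased sigma _ _ s0 kappaH zeta) => //.
  - by move=> x; apply: differentiable_continuous; exact: reg_c_diff problem_reg x.
  - exact: reg_c_C1 problem_reg.
  - by move=> k k0; have [V []] := G_variance k k0.
  - move=> k k0; have [V VE Vs] := G_variance k k0.
    apply: (integral_le_cond_exp_bound VE _ _ Vs); last exact: sqr_ge0.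
    exact: (@measurableT _ (g_sigma_algebraType _)).
have slln_all : {ae P, forall w, forall a, (fun N => N%:R^-1 *
     \sum_(i < N) (Y (kbar + i)%N w - Ytrue (kbar + i)%N w) a 0) @ \oo --> (0 : R)}.
  exact: filter_forall.
apply: filterS2 X_cvg slln_all => w Xw noise0.
have Yt := Ytrue_cvg w Xw; split => //.
(* Indices count from kbar, so that the averages are arithmetic means. *)
rewrite -(cvg_shiftn kbar); apply: cvg_mx_entries => a j; rewrite ord1.
have YavgN N : Yavg (N + kbar)%N w a 0 =
    arithmetic_mean (fun i => Ytrue (i + kbar)%N w a 0) N +
    N.+1%:R^-1 * \sum_(i < N.+1) (Y (kbar + i)%N w - Ytrue (kbar + i)%N w) a 0.
  rewrite YavgE ?leq_addl// addnK /arithmetic_mean/= seriesEnat/= mxE -mulrDr.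
  congr (_ * _); rewrite summxE -addSn -{1}[kbar]add0n big_addn addnK.
  rewrite !big_mkord -big_split/=; apply: eq_bigr => i _.
  by rewrite !mxE addnC addrC subrK.
under eq_fun do rewrite YavgN.
rewrite -[ystar a 0]addr0; apply: cvgD.
  apply: cesaro; rewrite (cvg_shiftn kbar (fun i => Ytrue i w a 0)).
  exact: cvg_entry.
have := noise0 a; rewrite -cvg_shiftS; exact.
Qed.
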